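(* Let $s\in(0,1)$ and let $E\subset\mathbb{R}^2$ be an $s$-minimal set in $\mathbb{R}^2$ which is a cone (i.e. $tE=E$ for every $t>0$), with neither $E$ nor $\mathbb{R}^2\setminus E$ of Lebesgue measure zero. Then $E$ is a half-plane (up to a set of Lebesgue measure zero).
   Context: For measurable $A,B\subset\mathbb{R}^n$ let $L(A,B):=\int_A\int_B\frac{dx\,dy}{|x-y|^{n+s}}$. For a measurable set $E\subset\mathbb{R}^n$ and an open set $\Omega\subset\mathbb{R}^n$, the nonlocal $s$-perimeter of $E$ in $\Omega$ is $$\mathrm{Per}_s(E,\Omega):=L(E\cap\Omega,\mathbb{R}^n\setminus E)+L(E\setminus\Omega,\Omega\setminus E).$$ The set $E$ is $s$-minimal in $\Omega$ if $\mathrm{Per}_s(E,\Omega)<+\infty$ and $\mathrm{Per}_s(E,\Omega)\le \mathrm{Per}_s(F,\Omega)$ for every measurable set $F$ with $E\setminus\Omega=F\setminus\Omega$. The set $E$ is $s$-minimal in $\mathbb{R}^n$ if it is $s$-minimal in the ball of radius $R$ centered at the origin of $\mathbb{R}^n$, for every $R>0$. Here $n=2$. A half-plane is a set of the form $\{x\in\mathbb{R}^2: x\cdot\nu>c\}$ with $\nu\in\mathbb{R}^2$, $|\nu|=1$, $c\in\mathbb{R}$. *)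

(* Defs.v *)
From HB Require Import structures.
From mathcomp Require Import all_boot all_order all_algebra.
From mathcomp Require Import all_classical all_reals all_analysis.
From mathcomp Require Import measurable_realfun.

Set Implicit Arguments.
Unset Strict Implicit.
Unset Printing Implicit Defensive.

Import Order.TTheory GRing.Theory Num.Theory.

Local Open Scope classical_set_scope.
Local Open Scope ring_scope.

(* The library has no Lebesgue measure on R^n; the plane is the product type,
   with the product of two copies of the one-dimensional Lebesgue measure. *)
Notation plane R := (measurableTypeR R * measurableTypeR R)%type.

Notation leb2 R := ((@lebesgue_measure R) \x (@lebesgue_measure R))%E.

Definition dot {R : realType} (x y : plane R) : R := x.1 * y.1 + x.2 * y.2.

(* The norm `|x| of the library on a product is the sup norm. *)
Definition enorm {R : realType} (x : plane R) : R := Num.sqrt (dot x x).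

(* [measurable] on the product means Borel, while sets are measurable in the
   sense of Lebesgue here: unions of a Borel set and a subset of a Borel set of
   measure zero. *)
Definition lebesgue_measurable {R : realType} (A : set (plane R)) : Prop :=
  completed_algebra_gen (leb2 R) A.

(* 1 / |x - y|^(2 + s). On the diagonal (a null set) this is 0, because
   0 `^ r = 0 for r != 0 and 0^-1 = 0. *)
Definition kernel {R : realType} (s : R) (x y : plane R) : R :=
  (enorm (x.1 - y.1, x.2 - y.2) `^ (2 + s))^-1.

(* The integral of a nonnegative function is the supremum of the integrals of
   the Borel simple functions below it, so it is the Lebesgue integral for
   Lebesgue measurable integrands too. *)
Definition interaction {R : realType} (s : R) (A B : set (plane R)) : \bar R :=
  (\int[leb2 R]_(x in A) \int[leb2 R]_(y in B) (kernel s x y)%:E)%E.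

Definition s_perimeter {R : realType} (s : R) (E Omega : set (plane R)) : \bar R :=
  (interaction s (E `&` Omega) (~` E) +
   interaction s (E `\` Omega) (Omega `\` E))%E.

Definition s_minimal_in {R : realType} (s : R) (Omega E : set (plane R)) : Prop :=
  [/\ lebesgue_measurable E,
      (s_perimeter s E Omega < +oo)%E &
      forall F : set (plane R), lebesgue_measurable F ->
        E `\` Omega = F `\` Omega ->
        (s_perimeter s E Omega <= s_perimeter s F Omega)%E].

Definition eball {R : realType} (r : R) : set (plane R) :=
  [set x | enorm x < r].

Definition s_minimal {R : realType} (s : R) (E : set (plane R)) : Prop :=
  forall r : R, 0 < r -> s_minimal_in s (eball r) E.

Definition cone {R : realType} (E : set (plane R)) : Prop :=
  forall t : R, 0 < t -> [set ((t * x.1, t * x.2) : plane R) | x in E] = E.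

Definition half_plane {R : realType} (H : set (plane R)) : Prop :=
  exists (nu : plane R) (c : R), enorm nu = 1 /\ H = [set x | c < dot x nu].

(* Main.v *)
Require Import Defs.
From HB Require Import structures.
From mathcomp Require Import all_boot all_order all_algebra.
From mathcomp Require Import all_classical all_reals all_analysis.
From mathcomp Require Import measurable_realfun ring lra.

(** Move [E] by the vector [v = (1, a)] on a large ball, cutting the translation
    off to nothing at distance [r]: let [E+] and [E-] be the images of [E] under
    [x |-> x + phi x v] and [x |-> x - phi x v], where [phi] is a cutoff with
    gradient of order [1 / r]. Expanding the kernel to second order, the terms of
    first order in [phi] cancel between the two images, so
    [[
      Per E+ + Per E- <= (2 + C / r ^ 2) Per E
    ]]
    in the ball of radius [r] ([kernel_deformation_le],
    [interaction_deform_both_ways]). For a cone the perimeter in that ball is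
    [r ^ (2 - s)] times the perimeter in the unit ball ([s_perimeter_ae_cone]), so
    the excess is [O(r ^ (- s))], which vanishes as [r] grows: this is where
    dimension two enters.

    Unions and intersections with [E+] are competitors too, and
    [[
      Per (E U E+) + Per (E n E+) + L(E \ E+, E+ \ E) <= Per E + Per E+
    ]]
    ([s_perimeter_submodular]). Minimality of [E] against [E U E+], [E n E+] and
    [E-] therefore bounds [L(E \ E+, E+ \ E)] by the excess
    ([interaction_setD_le_excess]). On a fixed ball [E+] is [E + v], hence the
    parts of [E \ (E + v)] and [(E + v) \ E] in that ball do not interact
    ([interaction_translate_eq0]); as the kernel is positive, one of them is null
    ([interaction_eq0]). So, up to null sets, [E + v] contains [E] or is contained
    in it, for every [v = (1, a)] ([translate_monotone]).

    The vectors [v] with [E + v] contained in [E] up to a null set form a convex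
    cone [P], as [E] is a cone, and [P] or [- P] contains each [(1, a)]. Such a [P]
    contains an open half-plane [H] ([half_plane_in_additive_cone]). By Tonelli
    some [x] in [E] has [x + H] in [E] up to a null set; shrinking this inclusion
    towards the origin gives [H] in [E]. The complement of [E] is treated in the
    same way with [- H] ([half_plane_filled]).

    The sets at hand are Lebesgue measurable, whereas Tonelli is used for Borel
    functions: interactions do not see null sets ([interaction_ae]), so [E] may be
    replaced by a Borel set ([s_minimal_borel]). *)

Set Implicit Arguments.
Unset Strict Implicit.
Unset Printing Implicit Defensive.

Import Order.TTheory GRing.Theory Num.Theory.
Import numFieldNormedType.Exports.

Local Open Scope classical_set_scope.
Local Open Scope ring_scope.

(** * Change of variables on the line *)

Section push_density.
Local Open Scope ereal_scope.
Context d1 d2 (X : measurableType d1) (Y : measurableType d2) (R : realType).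
Variables (mu : {measure set X -> \bar R}) (nu : {measure set Y -> \bar R}).
Variables (phi : X -> Y) (w : X -> R).
Hypothesis mphi : measurable_fun setT phi.
Hypothesis mw : measurable_fun setT w.
Hypothesis w0 : forall x, (0 <= w x)%R.
Hypothesis nuE : forall A, measurable A ->
  \int[mu]_(x in phi @^-1` A) (w x)%:E = nu A.

Import HBNNSimple.

(** The passage from sets to functions: the identity of measures [nuE] is the
    formula for indicators, and both sides are additive and continuous along the
    simple approximations of [f]. *)
Lemma ge0_integral_push_density (f : Y -> \bar R) :
  measurable_fun setT f -> (forall y, 0 <= f y) ->
  \int[mu]_x (f (phi x) * (w x)%:E) = \int[nu]_y f y.
Proof.
move=> mf f0.
have mphiA A : measurable A -> measurable (phi @^-1` A).
  by move=> mA; rewrite -(setTI (_ @^-1` _)); exact: mphi.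
pose f_ := nnsfun_approx measurableT mf.
have mind n k : measurable_fun setT (fun x => \1_(f_ n @^-1` [set k]) (phi x) : R).
  have mi : measurable_fun setT (\1_(f_ n @^-1` [set k]) : Y -> R) by [].
  exact: (measurableT_comp mi mphi).
have mfp n : measurable_fun setT (fun x => (f_ n (phi x))%:E * (w x)%:E).
  apply: emeasurable_funM; last exact/measurable_EFinP.
  by apply/measurable_EFinP; exact: (measurableT_comp _ mphi).
transitivity (limn (fun n => \int[mu]_x ((f_ n (phi x))%:E * (w x)%:E))).
  rewrite -monotone_convergence//; first 1 last.
  - by move=> n x _; rewrite mule_ge0// lee_fin.
  - move=> x _ m n mn; rewrite lee_wpmul2r// ?lee_fin//.
    exact/lefP/nd_nnsfun_approx.
  apply: eq_integral => x _; apply/esym/cvg_lim => //.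
  apply: cvgeZr => //.
  exact: cvg_nnsfun_approx.
transitivity (limn (fun n => \int[nu]_y (f_ n y)%:E)); last first.
  rewrite -monotone_convergence//.
  - apply: eq_integral => y _; apply/cvg_lim => //.
    exact: cvg_nnsfun_approx.
  - by move=> n; exact/measurable_EFinP.
  - by move=> n x _; rewrite lee_fin.
  - by move=> x _ m n mn; rewrite lee_fin; exact/lefP/nd_nnsfun_approx.
congr (limn _); apply/funext => n.
have step k : \int[mu]_x ((k * \1_(f_ n @^-1` [set k]) (phi x))%:E * (w x)%:E)
   = k%:E * nu (f_ n @^-1` [set k]).
  rewrite -nuE//.
  have [k0|k0] := leP 0%R k; last first.
    rewrite preimage_nnfun0// preimage_set0 integral_set0 mule0.
    by apply: integral0_eq => x _; rewrite indic0 mulr0 mul0e.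
  under eq_integral do rewrite EFinM -muleA.
  rewrite ge0_integralZl//; first 1 last.
  - by apply: emeasurable_funM; apply/measurable_EFinP.
  - by move=> x _; rewrite mule_ge0// lee_fin.
  congr (_ * _); rewrite [RHS]integral_mkcond.
  apply: eq_integral => x _; rewrite patchE/= indicE.
  have -> : (x \in phi @^-1` (f_ n @^-1` [set k])) =
    (phi x \in f_ n @^-1` [set k]) by apply/idP/idP; rewrite !inE.
  by case: ifPn; rewrite ?mul1e ?mul0e.
transitivity (\sum_(k \in range (f_ n))
    \int[mu]_x ((k * \1_(f_ n @^-1` [set k]) (phi x))%:E * (w x)%:E)).
  rewrite -ge0_integral_fsum//.
  - apply: eq_integral => x _; rewrite fimfunE -fsumEFin//.
    by rewrite ge0_mule_fsuml// => k; rewrite nnfun_muleindic_ge0.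
  - move=> r; apply: emeasurable_funM; last exact/measurable_EFinP.
    exact/measurable_EFinP/measurable_funM.
  - by move=> r x _; rewrite mule_ge0 ?nnfun_muleindic_ge0// lee_fin.
transitivity (\sum_(k \in range (f_ n))
    \int[nu]_y (k * \1_(f_ n @^-1` [set k]) y)%:E).
  apply: eq_fsbigr => r _.
  by rewrite step integralZl_indic_nnsfun// integral_indic// setIT.
rewrite -ge0_integral_fsum//.
- by apply: eq_integral => x _; rewrite fsumEFin// -fimfunE.
- by move=> r; exact/measurable_EFinP/measurable_funM.
- by move=> r x _; rewrite nnfun_muleindic_ge0.
Qed.

End push_density.

Section change_of_variables_1d.
Local Open Scope ereal_scope.
Context {R : realType}.
Local Notation mu := (@lebesgue_measure R).

(** By uniqueness of Lebesgue measure the formula need only be checked on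
    half-open intervals, where it is the hypothesis that [w] integrates to the
    increments of [T]. Nothing is differentiated, so that [T] may be piecewise
    affine. *)
Lemma ge0_integral_increasing_bijection
  (T S : measurableTypeR R -> measurableTypeR R) (w : measurableTypeR R -> R) :
  {homo T : x y / (x < y)%R} -> cancel T S -> cancel S T ->
  measurable_fun setT T -> measurable_fun setT w -> (forall x, (0 <= w x)%R) ->
  (forall a b : R, (a <= b)%R ->
    \int[mu]_(x in `]a, b]) (w x)%:E = (T b - T a)%:E) ->
  forall f : measurableTypeR R -> \bar R,
  measurable_fun setT f -> (forall y, 0 <= f y) ->
  \int[mu]_x (f (T x) * (w x)%:E) = \int[mu]_y f y.
Proof.
move=> incT TK SK mT mw w0 wE f mf f0.
apply: (@ge0_integral_push_density _ _ _ _ R mu mu T w mT mw w0) => // A mA.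
have mTA B : measurable B -> measurable (T @^-1` B).
  by move=> mB; rewrite -(setTI (_ @^-1` _)); exact: mT.
pose m B := \int[mu]_(x in T @^-1` B) (w x)%:E.
have m0 : m set0 = 0 by rewrite /m preimage_set0 integral_set0.
have mge0 B : 0 <= m B by apply: integral_ge0 => x _; rewrite lee_fin.
have msig : semi_sigma_additive m.
  move=> F mF tF mUF; rewrite /m preimage_bigcup ge0_integral_bigcup//=.
  - apply: is_cvg_nneseries_cond => n _ _.
    by apply: integral_ge0 => x _; rewrite lee_fin.
  - by move=> k; exact: mTA.
  - by apply/measurable_EFinP; exact: measurable_funS mw.
  - by move=> x _; rewrite lee_fin.
  - by apply/trivIsetP => i j _ _ ij; rewrite -preimage_setI;
      move/trivIsetP : tF => ->//; rewrite preimage_set0.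
pose m_mixin := isMeasure.Build _ _ _ m m0 mge0 msig.
pose M : {measure set (measurableTypeR R) -> \bar R} := HB.pack m m_mixin.
have := @lebesgue_measure_unique R M _ A mA.
rewrite /= => ->// _ [[a b] _ <-] /=; rewrite /m.
have leT x y : (T x <= T y)%R = (x <= y)%R.
  by apply: le_mono; exact: incT.
have -> : T @^-1` `]a, b] = `]S a, S b]%classic.
  apply/seteqP; split => x /=; rewrite !in_itv/= => /andP[ax xb];
   apply/andP; split.
  - by rewrite ltNge -leT SK -ltNge.
  - by rewrite -leT SK.
  - by rewrite ltNge -[a]SK leT -ltNge.
  - by rewrite -[b]SK leT.
have [ab|ba] := leP a b.
  rewrite wE ?SK; last by rewrite -leT !SK.
  by rewrite lebesgue_measure_itv/= lte_fin; case: ltgtP ab => // -> _; rewrite subrr.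
rewrite !set_itv_ge ?measure0 ?integral_set0//; rewrite bnd_simp -leNgt ?(ltW ba)//.
by rewrite -leT !SK ltW.
Qed.

Lemma ge0_integral_shift (c : R) (f : measurableTypeR R -> \bar R) :
  measurable_fun setT f -> (forall y, 0 <= f y) ->
  \int[mu]_x f (x + c)%R = \int[mu]_y f y.
Proof.
move=> mf f0.
rewrite -[RHS](@ge0_integral_increasing_bijection (fun x => x + c)%R
  (fun x => x - c)%R (cst 1%R))//.
- by apply: eq_integral => x _; rewrite mule1.
- by move=> x y xy; rewrite ltrD2r.
- by move=> x; rewrite addrK.
- by move=> x; rewrite subrK.
- by apply: measurable_funD.
- move=> a b ab; rewrite (integral_cst mu _ 1%:E)//= mul1e lebesgue_measure_itv/= lte_fin.
  case: ltgtP ab => // [_ _|-> _]; last by rewrite !subrr.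
  by rewrite -EFinB; congr EFin; rewrite opprD addrACA subrr addr0.
Qed.

Lemma ge0_integral_dilate (r : R) (f : measurableTypeR R -> \bar R) : (0 < r)%R ->
  measurable_fun setT f -> (forall y, 0 <= f y) ->
  r%:E * \int[mu]_x f (r * x)%R = \int[mu]_y f y.
Proof.
move=> r0 mf f0.
rewrite -[RHS](@ge0_integral_increasing_bijection (fun x => r * x)%R
  (fun x => r^-1 * x)%R (cst r))//.
- rewrite -ge0_integralZl// ?lee_fin ?ltW//.
    by apply: eq_integral => x _; rewrite muleC.
  by apply: (measurableT_comp mf); exact: measurable_funM.
- by move=> x y xy; rewrite ltr_pM2l.
- by move=> x; rewrite mulrA mulVf ?mul1r// gt_eqF.
- by move=> x; rewrite mulrA mulfV ?mul1r// gt_eqF.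
- by apply: measurable_funM.
- by move=> x /=; rewrite ltW.
- move=> a b ab; rewrite (integral_cst mu _ r%:E)//= lebesgue_measure_itv/= lte_fin.
  case: ltgtP ab => // [_ _|-> _]; last by rewrite !subrr mule0.
  by rewrite -EFinB -EFinM mulrBr.
Qed.

End change_of_variables_1d.

(** * Second order expansion of the kernel *)

Section kernel_inequality.
Context {R : realType}.
Implicit Types (a b d l q s u v : R).

(** Convexity of the exponential between [0] and [l], from its tangent at
    [a * l]: multiply by [expR (a * l)] the weighted sum of the bounds
    [1 + t <= expR t] at [t = (1 - a) * l] and [t = - a * l]. *)
Lemma expR_weighted_mean a l : 0 <= a -> a <= 1 ->
  expR (a * l) <= a * expR l + (1 - a).
Proof.
move=> a0 a1.
have h1 : a * (1 + (1 - a) * l) <= a * expR ((1 - a) * l).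
  by rewrite ler_wpM2l// expR_ge1Dx.
have h2 : (1 - a) * (1 + - (a * l)) <= (1 - a) * expR (- (a * l)).
  by rewrite ler_wpM2l ?subr_ge0// expR_ge1Dx.
have h : 1 <= a * expR ((1 - a) * l) + (1 - a) * expR (- (a * l)).
  by apply: le_trans (lerD h1 h2); rewrite le_eqVlt; apply/orP; left; apply/eqP; ring.
have := ler_wpM2l (expR_ge0 (a * l)) h.
rewrite mulr1 mulrDr !(mulrCA (expR (a * l))) -!expRD.
rewrite (_ : a * l + (1 - a) * l = l); last by ring.
by rewrite subrr expR0 mulr1.
Qed.

Lemma powRN_ge_tangent u q : -1 < u -> 0 <= q -> 1 - q * u <= (1 + u) `^ (- q).
Proof.
move=> u1 q0; rewrite /powR gt_eqF; last by lra.
apply: le_trans (expR_ge1Dx _).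
by rewrite lerD2l mulNr lerN2 ler_wpM2l// le_ln1Dx.
Qed.

(** Write [(1 + u) ^ - q] as [(1 + u) ^ - 2 * (1 + u) ^ (2 - q)]: the exponent
    [2 - q] lies in [[0, 1]], so Bernoulli's inequality bounds the second factor
    and a polynomial inequality is left. *)
Lemma powRN_le_parabola u q : - (3 / 4) <= u -> 1 <= q -> q <= 3 / 2 ->
  (1 + u) `^ (- q) <= 1 - q * u + 32 * u ^+ 2.
Proof.
move=> u1 q1 q2.
have y0 : 0 < 1 + u by lra.
rewrite /powR gt_eqF//.
have -> : - q * ln (1 + u) = (2 - q) * ln (1 + u) - (ln (1 + u) + ln (1 + u)).
  by ring.
rewrite expRB expRD lnK ?posrE// ler_pdivrMr ?mulr_gt0//.
apply: le_trans.
  by apply: expR_weighted_mean; lra.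
rewrite lnK ?posrE//.
rewrite -subr_ge0.
have -> : (1 - q * u + 32 * u ^+ 2) * ((1 + u) * (1 + u)) -
  ((2 - q) * (1 + u) + (1 - (2 - q))) =
  u ^+ 2 * (32 * (1 + u) ^+ 2 + (1 - 2 * q - q * u)) by ring.
apply: mulr_ge0; first exact: sqr_ge0.
have [u0|u0] := leP 0 u; nra.
Qed.

(** [u] and [v] are the relative changes of a squared distance under two opposite
    deformations, [a] and [b] the infinitesimal Jacobians. All terms of first
    order cancel or have a sign: [u + v] is nonnegative, and [a + b] multiplies the
    difference of the two powers, which is itself of order [d]. *)
Lemma sum_deformed_powRN a b d u v q : 0 <= d -> d <= 1 / 4 ->
  1 <= q -> q <= 3 / 2 -> `|a| <= d -> `|b| <= d ->
  `|u| <= 3 * d -> `|v| <= 3 * d -> 0 <= u + v ->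
  (1 + a) * (1 + b) * (1 + u) `^ (- q) + (1 - a) * (1 - b) * (1 + v) `^ (- q) <=
  2 + 1000 * d ^+ 2.
Proof.
move=> d0 d4 q1 q2; rewrite !ler_norml => /andP[a1 a2] /andP[b1 b2].
move=> /andP[u1 u2] /andP[v1 v2] uv.
have Gu := @powRN_le_parabola u q ltac:(lra) q1 q2.
have Gv := @powRN_le_parabola v q ltac:(lra) q1 q2.
have Lu := @powRN_ge_tangent u q ltac:(lra) ltac:(lra).
have Lv := @powRN_ge_tangent v q ltac:(lra) ltac:(lra).
move: Gu Gv Lu Lv; set G := _ `^ _; set H := _ `^ _ => Gu Gv Lu Lv.
(* the constants: 576 = 2 * 32 * 9 and 90 >= 6 * q + 32 * 9 / 4, as d <= 1 / 4 *)
have u2d : u ^+ 2 <= 9 * d ^+ 2 by nra.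
have v2d : v ^+ 2 <= 9 * d ^+ 2 by nra.
have GH : G + H <= 2 + 576 * d ^+ 2 by nra.
have dd : d ^+ 2 <= d / 4 by nra.
have GH1 : G - H <= 90 * d by nra.
have GH2 : H - G <= 90 * d by nra.
have ab1 : a * b <= d ^+ 2 by nra.
have ab2 : - d ^+ 2 <= a * b by nra.
have GH0 : 0 <= G + H by rewrite addr_ge0// powR_ge0.
have -> : (1 + a) * (1 + b) * G + (1 - a) * (1 - b) * H =
  (G + H) + a * b * (G + H) + (a + b) * (G - H) by ring.
have h1 : a * b * (G + H) <= d ^+ 2 * (2 + 576 * d ^+ 2).
  apply: (@le_trans _ _ (d ^+ 2 * (G + H))); first by rewrite ler_wpM2r.
  by rewrite ler_wpM2l// sqr_ge0.
have h2 : (a + b) * (G - H) <= 2 * d * (90 * d).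
  apply: le_trans (ler_norm _) _; rewrite normrM; apply: ler_pM => //.
    by rewrite ler_norml; apply/andP; split; lra.
  by rewrite ler_norml; apply/andP; split; lra.
have d44 : d ^+ 2 * d ^+ 2 <= d ^+ 2 * (1 / 16) by rewrite ler_wpM2l ?sqr_ge0//; nra.
nra.
Qed.

Lemma dot_ge0 (z : plane R) : 0 <= dot z z.
Proof. by rewrite /dot -!expr2 addr_ge0 ?sqr_ge0. Qed.

Lemma kernelE s (x y : plane R) : let z := (x.1 - y.1, x.2 - y.2) : plane R in
  Defs.kernel s x y = (dot z z) `^ (- (1 + s / 2)).
Proof.
rewrite /Defs.kernel /enorm/=; set D := dot _ _.
rewrite -powR12_sqrt ?dot_ge0// -powRrM powRN; congr (_ `^ _)^-1.
by field.
Qed.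

Lemma kernel_ge0 s (x y : plane R) : 0 <= Defs.kernel s x y.
Proof. by rewrite kernelE powR_ge0. Qed.

(** The pairs [(x1, y1)] and [(x2, y2)] are the images of [(x, y)] under the two
    opposite deformations: their differences are [x - y + w] and [x - y - w]. *)
Lemma kernel_deformation_le (s a b d : R) (x y w x1 y1 x2 y2 : plane R) :
  0 < s -> s < 1 -> 0 <= d -> d <= 1 / 4 -> `|a| <= d -> `|b| <= d ->
  x1.1 - y1.1 = x.1 - y.1 + w.1 -> x1.2 - y1.2 = x.2 - y.2 + w.2 ->
  x2.1 - y2.1 = x.1 - y.1 - w.1 -> x2.2 - y2.2 = x.2 - y.2 - w.2 ->
  dot w w <= d ^+ 2 * dot (x.1 - y.1, x.2 - y.2) (x.1 - y.1, x.2 - y.2) ->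
  (1 + a) * (1 + b) * Defs.kernel s x1 y1 + (1 - a) * (1 - b) * Defs.kernel s x2 y2 <=
  (2 + 1000 * d ^+ 2) * Defs.kernel s x y.
Proof.
move=> s0 s1 d0 d4 ad bd e11 e12 e21 e22.
rewrite !kernelE e11 e12 e21 e22; set z : plane R := (_, _) => wz.
have [z0|z0] := eqVneq (dot z z) 0.
  move: wz; rewrite z0 mulr0 => w0.
  have {}w0 : dot w w = 0 by apply/eqP; rewrite eq_le w0 dot_ge0.
  have sq0 (p : plane R) : dot p p = 0 -> p.1 = 0 /\ p.2 = 0.
    rewrite /dot -!expr2 => /eqP; rewrite paddr_eq0 ?sqr_ge0// !sqrf_eq0.
    by move=> /andP[/eqP-> /eqP->].
  have [w1 w2] := sq0 _ w0; have [/= z1 z2] := sq0 _ z0.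
  rewrite /= w1 w2 z1 z2 !subr0 !addr0 /dot/= mulr0 addr0 powR0 ?mulr0 ?addr0//.
  by rewrite oppr_eq0 gt_eqF//; lra.
have N0 : 0 < dot z z by rewrite lt_neqAle eq_sym z0 dot_ge0.
pose c := dot z w.
(* Cauchy-Schwarz, from the Lagrange identity *)
have cs : c ^+ 2 <= dot z z * dot w w.
  rewrite -subr_ge0 /c /dot.
  set p := z.1; set q := z.2.
  rewrite (_ : _ - _ = (p * w.2 - q * w.1) ^+ 2) ?sqr_ge0//; ring.
set N := dot z z in wz N0 cs *.
have cd : `|c| <= d * N.
  rewrite -ler_sqr ?nnegrE// ?mulr_ge0 ?(ltW N0)//.
  rewrite real_normK ?num_real//; apply: le_trans cs _.
  apply: le_trans (ler_wpM2l (ltW N0) wz) _.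
  by rewrite le_eqVlt; apply/orP; left; apply/eqP; ring.
pose u := (2 * c + dot w w) / N; pose v := (- 2 * c + dot w w) / N.
have W0 := dot_ge0 w.
have -> : dot (z.1 + w.1, z.2 + w.2) (z.1 + w.1, z.2 + w.2) = N * (1 + u).
  rewrite mulrDr mulr1 /u mulrCA mulfV ?gt_eqF// mulr1 /N /c /dot/=; ring.
have -> : dot (z.1 - w.1, z.2 - w.2) (z.1 - w.1, z.2 - w.2) = N * (1 + v).
  rewrite mulrDr mulr1 /v mulrCA mulfV ?gt_eqF// mulr1 /N /c /dot/=; ring.
have dN : d ^+ 2 * N <= d * N by rewrite ler_wpM2r ?(ltW N0)//; nra.
move: cd; rewrite ler_norml => /andP[c1 c2].
have u3 : `|u| <= 3 * d.
  rewrite ler_norml /u ler_pdivlMr// ler_pdivrMr//; apply/andP; split; lra.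
have v3 : `|v| <= 3 * d.
  rewrite ler_norml /v ler_pdivlMr// ler_pdivrMr//; apply/andP; split; lra.
have uv : 0 <= u + v.
  rewrite /u /v -mulrDl divr_ge0 ?(ltW N0)//; lra.
have := @sum_deformed_powRN a b d u v (1 + s / 2) d0 d4 ltac:(lra) ltac:(lra)
  ad bd u3 v3 uv.
move: u3 v3; rewrite !ler_norml => /andP[u4 u5] /andP[v4 v5].
rewrite !powRM ?(ltW N0)//; [|lra|lra].
move=> /(ler_wpM2r (powR_ge0 N (- (1 + s / 2)))); apply: le_trans.
rewrite le_eqVlt; apply/orP; left; apply/eqP; ring.
Qed.

Lemma kernel_dilate (s r : R) (x y : plane R) : 0 < r ->
  Defs.kernel s (r * x.1, r * x.2) (r * y.1, r * y.2) =
  r `^ (- (2 + s)) * Defs.kernel s x y.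
Proof.
move=> r0; rewrite !kernelE/= -!mulrBr.
set z : plane R := (x.1 - y.1, x.2 - y.2).
have -> : dot (r * (x.1 - y.1), r * (x.2 - y.2)) (r * (x.1 - y.1), r * (x.2 - y.2)) = r ^+ 2 * dot z z.
  rewrite /dot/=; ring.
rewrite powRM ?dot_ge0 ?sqr_ge0//; congr (_ * _).
rewrite -powR_mulrn ?(ltW r0)// -powRrM; congr (_ `^ _).
by field.
Qed.

Lemma measurable_kernel s :
  measurable_fun setT (fun p : plane R * plane R => Defs.kernel s p.1 p.2).
Proof.
have -> : (fun p : plane R * plane R => Defs.kernel s p.1 p.2) =
  (fun t => t `^ (- (1 + s / 2))) \o
  (fun p : plane R * plane R => (p.1.1 - p.2.1) * (p.1.1 - p.2.1) +
    (p.1.2 - p.2.2) * (p.1.2 - p.2.2)).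
  by apply/funext => p; rewrite kernelE.
apply: measurableT_comp; first exact: measurable_powR.
have m1 : measurable_fun setT (fun p : plane R * plane R => p.1.1 - p.2.1).
  apply: measurable_funB.
    exact: (measurableT_comp measurable_fst measurable_fst).
  exact: (measurableT_comp measurable_fst measurable_snd).
have m2 : measurable_fun setT (fun p : plane R * plane R => p.1.2 - p.2.2).
  apply: measurable_funB.
    exact: (measurableT_comp measurable_snd measurable_fst).
  exact: (measurableT_comp measurable_snd measurable_snd).
by apply: measurable_funD; apply: measurable_funM.
Qed.

End kernel_inequality.

(** * A piecewise affine cutoff *)

Section cutoff.
Context {R : realType}.
Local Notation mu := (@lebesgue_measure R).

Definition clamp (p q x : R) : R := Num.max p (Num.min x q).

Lemma clampP p q x : p <= q -> [\/ x <= p /\ clamp p q x = p,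
  [/\ p <= x, x <= q & clamp p q x = x] | q <= x /\ clamp p q x = q].
Proof.
move=> pq; rewrite /clamp; have [xq|/ltW qx] := leP x q; last first.
  by rewrite (max_idPr pq); constructor 3.
have [px|/ltW xp] := leP p x; first by constructor 2.
by constructor 1.
Qed.

(** [clamp p q] is a primitive of the indicator of [[p, q]]: sums of such
    functions are piecewise affine, with a known derivative. *)
Lemma lebesgue_measure_clamp p q a b : p <= q -> a <= b ->
  mu (`]p, q] `&` `]a, b])%classic = (clamp p q b - clamp p q a)%:E.
Proof.
move=> pq ab.
have -> : (`]p, q] `&` `]a, b])%classic = `]Num.max p a, Num.min q b]%classic.
  apply/seteqP; split => x /=; rewrite !in_itv/= gt_max le_min.
    by move=> [/andP[-> ->] /andP[-> ->]].
  by move=> /andP[/andP[-> ->] /andP[-> ->]].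
have -> : mu `]Num.max p a, Num.min q b]%classic =
    (Num.max 0 (Num.min q b - Num.max p a))%:E.
  rewrite lebesgue_measure_itv/= lte_fin -EFinB -subr_gt0.
  by case: ltP.
congr EFin; case: (leP 0 (Num.min q b - Num.max p a));
case: (clampP a pq) => [[? ->]|[? ? ->]|[? ->]];
  case: (clampP b pq) => [[? ->]|[? ? ->]|[? ->]].
all: have [] := leP p a; have [] := leP q b; move=> *; lra.
Qed.

Variable rho : R.
Hypothesis rho0 : 0 < rho.

(** The trapezoid equal to [1] on [[- rho, rho]] and to [0] off
    [[- 2 rho, 2 rho]]; the constant [3] compensates the values [- rho] and [rho]
    that the clamps take at the origin. *)
Definition cutoff (x : R) : R :=
  3 + (clamp (- (2 * rho)) (- rho) x - clamp rho (2 * rho) x) / rho.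

Definition dcutoff (x : measurableTypeR R) : R :=
  (\1_(`]- (2 * rho), - rho]) x - \1_(`]rho, 2 * rho]) x) / rho.

Let lo : - (2 * rho) <= - rho. Proof. by have := rho0; lra. Qed.
Let hi : rho <= 2 * rho. Proof. by have := rho0; lra. Qed.

Lemma cutoff_eq1 x : `|x| <= rho -> cutoff x = 1.
Proof.
have r0 := rho0; rewrite ler_norml /cutoff => /andP[x1 x2].
suff -> : clamp (- (2 * rho)) (- rho) x - clamp rho (2 * rho) x = - (2 * rho).
  by field; rewrite gt_eqF.
case: (clampP x lo) => [[? ->]|[? ? ->]|[? ->]];
  case: (clampP x hi) => [[? ->]|[? ? ->]|[? ->]]; lra.
Qed.

Lemma cutoff_eq0 x : 2 * rho <= `|x| -> cutoff x = 0.
Proof.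
have r0 := rho0; rewrite ler_normr /cutoff => x1.
suff -> : clamp (- (2 * rho)) (- rho) x - clamp rho (2 * rho) x = - (3 * rho).
  by field; rewrite gt_eqF.
case/orP: x1 => x1; case: (clampP x lo) => [[? ->]|[? ? ->]|[? ->]];
  case: (clampP x hi) => [[? ->]|[? ? ->]|[? ->]]; lra.
Qed.

Lemma cutoff_itv x : 0 <= cutoff x <= 1.
Proof.
have r0 := rho0; rewrite /cutoff; set D := _ - _.
have : - (3 * rho) <= D <= - (2 * rho).
  rewrite /D; apply/andP; case: (clampP x lo) => [[? ->]|[? ? ->]|[? ->]];
  case: (clampP x hi) => [[? ->]|[? ? ->]|[? ->]]; split; lra.
move=> /andP[D1 D2]; apply/andP; split.
  by rewrite -lerBlDl sub0r ler_pdivlMr//; lra.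
by rewrite -lerBrDl ler_pdivrMr//; lra.
Qed.

Lemma cutoff_lipschitz x y : `|cutoff x - cutoff y| <= 2 / rho * `|x - y|.
Proof.
wlog xy : x y / x <= y.
  move=> h; have [/h//|/ltW/h] := leP x y.
  by rewrite distrC (distrC y).
rewrite distrC (distrC x) (ger0_norm (_ : 0 <= y - x)) ?subr_ge0//.
rewrite /cutoff opprD addrACA subrr add0r -mulrBl mulrAC normrM.
rewrite (@ger0_norm _ rho^-1) ?invr_ge0 ?(ltW rho0)// ler_wpM2r ?invr_ge0 ?(ltW rho0)//.
rewrite ler_norml; apply/andP.
(* both clamps are nondecreasing and do not expand distances *)
have bd p q : p <= q -> clamp p q x <= clamp p q y /\
    clamp p q y - clamp p q x <= y - x.
  move=> pq; case: (clampP x pq) => [[? ->]|[? ? ->]|[? ->]];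
  case: (clampP y pq) => [[? ->]|[? ? ->]|[? ->]]; split; lra.
have [b1 b2] := bd _ _ lo; have [b3 b4] := bd _ _ hi.
split; lra.
Qed.

Lemma continuous_cutoff : continuous cutoff.
Proof.
have cc p q : continuous (clamp p q).
  move=> x; apply: (@continuous_max _ _ (cst p) (fun x => Num.min x q)).
    exact: cvg_cst.
  by apply: (@continuous_min _ _ id (cst q)); [exact: cvg_id|exact: cvg_cst].
move=> x; apply: cvgD; first exact: cvg_cst.
by apply: cvgM; [apply: cvgB; exact: cc|exact: cvg_cst].
Qed.

Lemma measurable_cutoff : measurable_fun setT (cutoff : measurableTypeR R -> R).
Proof. exact: continuous_measurable_fun continuous_cutoff. Qed.

Lemma measurable_dcutoff : measurable_fun setT dcutoff.
Proof.
by apply: measurable_funM => //; apply: measurable_funB => //; exact: measurable_indic.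
Qed.

Lemma dcutoff_bound x : `|dcutoff x| <= rho^-1.
Proof.
rewrite /dcutoff normrM (@ger0_norm _ rho^-1) ?invr_ge0 ?(ltW rho0)//.
rewrite -[leRHS]mul1r ler_wpM2r ?invr_ge0 ?(ltW rho0)//.
rewrite !indicE; case: (_ \in _); case: (_ \in _);
 by rewrite ?subrr ?subr0 ?sub0r ?normrN ?normr0 ?normr1.
Qed.

(** [dcutoff] changes sign, whereas additivity of the integral is used for
    nonnegative functions: adding [(1 - c) / rho] and [(1 + c) / rho] times the
    indicators of the two slopes to the integrand makes both sides sums of
    nonnegative terms. *)
Lemma integral_1Ddcutoff c a b : `|c| <= 1 -> 1 <= rho -> a <= b ->
  (\int[mu]_(x in `]a, b]) (1 + c * dcutoff x)%:E =
   ((b + c * cutoff b) - (a + c * cutoff a))%:E)%E.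
Proof.
rewrite ler_norml => /andP[c1 c2] rho1 ab.
pose I1 := `]- (2 * rho), - rho]%classic : set (measurableTypeR R).
pose I2 := `]rho, 2 * rho]%classic : set (measurableTypeR R).
have wnn x : 0 <= 1 + c * dcutoff x.
  have := dcutoff_bound x; have : rho^-1 <= 1 by rewrite invf_le1.
  rewrite ler_norml => h /andP[h1 h2]; nra.
have mw : measurable_fun setT (fun x => 1 + c * dcutoff x).
  by apply: measurable_funD => //; apply: measurable_funM => //; exact: measurable_dcutoff.
have mi I k : measurable I -> measurable_fun setT
    (fun x : measurableTypeR R => k * \1_I x : R).
  by move=> mI; apply: measurable_funM => //; exact: measurable_indic.
have iI p q k : 0 <= k -> p <= q ->
    (\int[mu]_(x in `]a, b]) (k * \1_(`]p, q]%classic) x)%:E =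
    (k * (clamp p q b - clamp p q a))%:E)%E.
  move=> k0 pq; under eq_integral do rewrite EFinM.
  rewrite ge0_integralZl//.
  - by rewrite integral_indic//= lebesgue_measure_clamp// EFinM.
  - apply/measurable_EFinP; by apply: measurable_funTS; exact: measurable_indic.
have i0 : 0 <= rho^-1 by rewrite invr_ge0 ltW.
have c1' : 0 <= (1 - c) / rho by rewrite mulr_ge0// subr_ge0.
have c2' : 0 <= (1 + c) / rho by rewrite mulr_ge0//; lra.
have E : (\int[mu]_(x in `]a, b]) ((1 + c * dcutoff x)%:E +
     ((1 - c) / rho * \1_I1 x)%:E + ((1 + c) / rho * \1_I2 x)%:E) =
   \int[mu]_(x in `]a, b]) (1%:E + (rho^-1 * \1_I1 x)%:E + (rho^-1 * \1_I2 x)%:E))%E.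
  apply: eq_integral => x _; rewrite -!EFinD; congr EFin.
  rewrite /dcutoff -/I1 -/I2; field; rewrite gt_eqF//.
have p1 k I x : 0 <= k -> (0 <= (k * \1_I x)%:E :> \bar R)%E.
  by move=> k0; rewrite lee_fin mulr_ge0.
have mE k I : measurable I -> measurable_fun `]a, b]%classic
   (fun x : measurableTypeR R => (k * \1_I x)%:E : \bar R).
  by move=> mI; apply/measurable_EFinP; apply: measurable_funTS (mi I k mI).
have mwE : measurable_fun `]a, b]%classic
   (fun x : measurableTypeR R => (1 + c * dcutoff x)%:E : \bar R).
  by apply/measurable_EFinP; apply: measurable_funTS mw.
have pw x : (0 <= (1 + c * dcutoff x)%:E :> \bar R)%E by rewrite lee_fin.
have D2 (f g h : measurableTypeR R -> \bar R) :
    (forall x, 0 <= f x)%E -> (forall x, 0 <= g x)%E -> (forall x, 0 <= h x)%E ->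
    measurable_fun `]a, b]%classic f -> measurable_fun `]a, b]%classic g ->
    measurable_fun `]a, b]%classic h ->
    (\int[mu]_(x in `]a, b]) (f x + g x + h x) = \int[mu]_(x in `]a, b]) f x +
      \int[mu]_(x in `]a, b]) g x + \int[mu]_(x in `]a, b]) h x)%E.
  move=> f0 g0 h0 mf mg mh; rewrite ge0_integralD//.
  - by rewrite ge0_integralD.
  - by move=> x _; rewrite adde_ge0.
  - exact: emeasurable_funD.
move: E; rewrite !D2//; try exact: mE; try by move=> x; exact: p1.
rewrite (iI _ _ _ c1' lo) (iI _ _ _ c2' hi) (iI _ _ _ i0 lo) (iI _ _ _ i0 hi).
rewrite (integral_cst mu _ 1%:E)//= mul1e lebesgue_measure_itv/= lte_fin.
have -> : (if a < b then (b%:E - a%:E)%E else 0%E) = (b - a)%:E.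
  by case: ltgtP ab => // -> _; rewrite subrr.
have : (0 <= \int[mu]_(x in `]a, b]) (1 + c * dcutoff x)%:E)%E.
  by apply: integral_ge0 => x _.
case: (integral _ _ _) => [r _ | // | //].
rewrite -!EFinD => -[E]; congr EFin; rewrite /cutoff.
move: E; set A := clamp _ _ _; set B := clamp _ _ _; set C := clamp _ _ _;
  set D := clamp _ _ _ => E.
have -> : r = (r + (1 - c) / rho * (A - B) + (1 + c) / rho * (C - D)) -
  (1 - c) / rho * (A - B) - (1 + c) / rho * (C - D) by ring.
by rewrite E; field; rewrite gt_eqF.
all: by apply: mE; exact: measurable_itv.
Qed.

End cutoff.

(** * Change of variables in the plane *)

Section plane_change_of_variables.
Context {R : realType}.
Local Notation mu1 := (@lebesgue_measure R).
Local Notation mu := (leb2 R).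
Implicit Types (f : plane R -> \bar R).

Lemma ge0_integral_plane12 f : measurable_fun setT f -> (forall x, 0 <= f x)%E ->
  (\int[mu]_x f x = \int[mu1]_u \int[mu1]_t f (u, t))%E.
Proof. by move=> mf f0; rewrite fubini_tonelli1. Qed.

Lemma ge0_integral_plane21 f : measurable_fun setT f -> (forall x, 0 <= f x)%E ->
  (\int[mu]_x f x = \int[mu1]_t \int[mu1]_u f (u, t))%E.
Proof. by move=> mf f0; rewrite fubini_tonelli2. Qed.

Lemma measurable_plane_fun (h k : plane R -> measurableTypeR R) :
  measurable_fun setT h -> measurable_fun setT k ->
  measurable_fun setT (fun x => (h x, k x) : plane R).
Proof. exact: measurable_fun_pair. Qed.

Let m1 : measurable_fun setT (fst : plane R -> R) := measurable_fst.
Let m2 : measurable_fun setT (snd : plane R -> R) := measurable_snd.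

Definition shear (a : R) (x : plane R) : plane R := (x.1, x.2 + a * x.1).

Definition translate (v x : plane R) : plane R := (x.1 + v.1, x.2 + v.2).

Definition dilate (r : R) (x : plane R) : plane R := (r * x.1, r * x.2).

Lemma shearK a : cancel (shear a) (shear (- a)).
Proof. by move=> [u t]; rewrite /shear/= mulNr addrK. Qed.

Lemma shearNK a : cancel (shear (- a)) (shear a).
Proof. by move=> [u t]; rewrite /shear/= mulNr subrK. Qed.

Lemma dilateK r : r != 0 -> cancel (dilate r) (dilate r^-1).
Proof. by move=> r0 [u t]; rewrite /dilate/= !mulKf. Qed.

Lemma measurable_shear a : measurable_fun setT (shear a).
Proof.
apply: measurable_plane_fun => //; apply: measurable_funD => //.
exact: measurable_funM.
Qed.

Lemma measurable_translate v : measurable_fun setT (translate v).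
Proof. by apply: measurable_plane_fun; apply: measurable_funD. Qed.

Lemma measurable_dilate r : measurable_fun setT (dilate r).
Proof. by apply: measurable_plane_fun; apply: measurable_funM. Qed.

Lemma ge0_integral_shear a f :
  measurable_fun setT f -> (forall x, 0 <= f x)%E ->
  (\int[mu]_x f (shear a x) = \int[mu]_x f x)%E.
Proof.
move=> mf f0.
have mfs : measurable_fun setT (fun x => f (shear a x)).
  exact: (measurableT_comp mf (measurable_shear a)).
rewrite (ge0_integral_plane12 mfs (fun x => f0 _)) (ge0_integral_plane12 mf f0).
apply: eq_integral => u _.
exact: (@ge0_integral_shift _ (a * u) (fun t => f (u, t))
  (measurable_fun_pair2 u mf) (fun t => f0 (u, t))).
Qed.

Lemma ge0_integral_translate v f :
  measurable_fun setT f -> (forall x, 0 <= f x)%E ->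
  (\int[mu]_x f (translate v x) = \int[mu]_x f x)%E.
Proof.
move=> mf f0.
have mfs : measurable_fun setT (fun x => f (translate v x)).
  exact: (measurableT_comp mf (measurable_translate v)).
rewrite (ge0_integral_plane12 mfs (fun x => f0 _)) (ge0_integral_plane12 mf f0).
have mF := @measurable_fun_fubini_tonelli_F _ _ _ _ R mu1 f mf f0.
rewrite -[RHS](ge0_integral_shift v.1 mF); last by move=> u; apply: integral_ge0.
apply: eq_integral => u _.
exact: (@ge0_integral_shift _ v.2 (fun t => f ((u + v.1)%R, t))
  (measurable_fun_pair2 _ mf) (fun t => f0 _)).
Qed.

Lemma ge0_integral_dilate_plane r f : 0 < r ->
  measurable_fun setT f -> (forall x, 0 <= f x)%E ->
  ((r ^+ 2)%:E * \int[mu]_x f (dilate r x) = \int[mu]_x f x)%E.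
Proof.
move=> r0 mf f0.
have mfs : measurable_fun setT (fun x => f (dilate r x)).
  exact: (measurableT_comp mf (measurable_dilate r)).
rewrite (ge0_integral_plane12 mfs (fun x => f0 _)) (ge0_integral_plane12 mf f0).
have mF := @measurable_fun_fubini_tonelli_F _ _ _ _ R mu1 f mf f0.
rewrite -[RHS](ge0_integral_dilate r0 mF); last by move=> u; apply: integral_ge0.
rewrite expr2 EFinM -muleA; congr (_ * _)%E.
rewrite -ge0_integralZl//; first last.
- by rewrite lee_fin ltW.
- by move=> u _; apply: integral_ge0.
- exact: (@measurable_fun_fubini_tonelli_F _ _ _ _ R mu1 _ mfs (fun x => f0 _)).
apply: eq_integral => u _.
exact: (@ge0_integral_dilate _ r (fun t => f ((r * u)%R, t)) r0
  (measurable_fun_pair2 _ mf) (fun t => f0 _)).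
Qed.

(** The perturbation is too flat to stop [x + g x] from increasing, and moves
    points by at most [1], whence surjectivity by the intermediate value
    theorem. *)
Lemma lipschitz_perturbation_bijection (g : R -> R) :
  (forall x y, `|g x - g y| <= 1 / 2 * `|x - y|) -> (forall x, `|g x| <= 1) ->
  continuous g -> exists S : R -> R, [/\ {homo (fun x => x + g x) : x y / x < y},
    cancel (fun x => x + g x) S & cancel S (fun x => x + g x)].
Proof.
move=> gl g1 cg.
have inc : {homo (fun x => x + g x) : x y / x < y}.
  move=> x y xy; have := gl x y; rewrite (ltr0_norm (_ : x - y < 0)) ?subr_lt0//.
  by rewrite ler_norml => /andP[_]; lra.
have inc' x y : x < y -> x + g x < y + g y by exact: inc.
have surj y : exists x, x + g x = y.
  have := g1 (y - 1); have := g1 (y + 1); rewrite !ler_norml => /andP[h1 h2] /andP[h3 h4].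
  have [|||x _ <-] := @IVT R (fun x => x + g x) (y - 1) (y + 1) y.
  - by lra.
  - by apply: continuous_subspaceT => z; apply: cvgD; [exact: cvg_id|exact: cg].
  - by rewrite ge_min le_max; apply/andP; split; apply/orP; [left|right]; lra.
  - by exists x.
exists (fun y => sval (cid (surj y))); split => //.
- move=> x; case: cid => z /= zx.
  by have [/inc'|/inc'|//] := ltgtP z x; rewrite zx ltxx.
- by move=> y; case: cid.
Qed.

Section deformation.
Variables (rho a eps : R).
Hypothesis rho4 : 4 <= rho.
Hypothesis eps1 : `|eps| <= 1.

Local Notation chi := (cutoff rho).

Let rho0 : 0 < rho. Proof. by have := rho4; lra. Qed.

Definition bump (x : plane R) : R := chi x.1 * chi x.2.

(** The deformation along the first axis. It preserves each horizontal line, so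
    its Jacobian is that of a function of one variable. *)
Definition hdeform (x : plane R) : plane R := (x.1 + eps * chi x.2 * chi x.1, x.2).

Definition hjacobian (x : plane R) : R := 1 + eps * chi x.2 * dcutoff rho x.1.

Let coef_le1 t : `|eps * chi t| <= 1.
Proof.
rewrite normrM; have /andP[c0 c1] := cutoff_itv rho0 t.
by rewrite (ger0_norm c0) mulr_ile1.
Qed.

Let slice_bijection t : exists S : R -> R,
  [/\ {homo (fun x => x + eps * chi t * chi x) : x y / x < y},
    cancel (fun x => x + eps * chi t * chi x) S &
    cancel S (fun x => x + eps * chi t * chi x)].
Proof.
apply: (@lipschitz_perturbation_bijection (fun x => eps * chi t * chi x)).
- move=> x y; rewrite -mulrBr normrM.
  apply: (@le_trans _ _ `|chi x - chi y|).
    by rewrite -[leRHS]mul1r ler_wpM2r.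
  apply: le_trans (cutoff_lipschitz rho0 x y) _; rewrite ler_wpM2r//.
  by rewrite ler_pdivrMr//; have := rho4; lra.
- move=> x; rewrite normrM; have /andP[c0 c1] := cutoff_itv rho0 x.
  by rewrite (ger0_norm c0) mulr_ile1.
- by move=> x; apply: cvgM; [exact: cvg_cst|exact: continuous_cutoff].
Qed.

Let mchi1 : measurable_fun setT (fun x : plane R => chi x.1).
Proof. exact: (measurableT_comp (measurable_cutoff rho) m1). Qed.

Let mchi2 : measurable_fun setT (fun x : plane R => chi x.2).
Proof. exact: (measurableT_comp (measurable_cutoff rho) m2). Qed.

Lemma measurable_hdeform : measurable_fun setT hdeform.
Proof.
apply: measurable_plane_fun => //.
by apply: measurable_funD => //; do 2 apply: measurable_funM => //.
Qed.

Lemma measurable_hjacobian : measurable_fun setT hjacobian.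
Proof.
apply: measurable_funD => //; apply: measurable_funM; first exact: measurable_funM.
exact: (measurableT_comp (measurable_dcutoff rho) m1).
Qed.

Lemma hjacobian_dev x : `|eps * chi x.2 * dcutoff rho x.1| <= rho^-1.
Proof.
rewrite normrM -[leRHS]mul1r ler_pM//; exact: (dcutoff_bound rho0).
Qed.

Lemma hjacobian_ge0 x : 0 <= hjacobian x.
Proof.
have := hjacobian_dev x; have : rho^-1 <= 1 by rewrite invf_le1//; have := rho4; lra.
by rewrite /hjacobian ler_norml => h /andP[h1 h2]; lra.
Qed.

Lemma ge0_integral_hdeform f :
  measurable_fun setT f -> (forall x, 0 <= f x)%E ->
  (\int[mu]_x (f (hdeform x) * (hjacobian x)%:E) = \int[mu]_x f x)%E.
Proof.
move=> mf f0.
have mfJ : measurable_fun setT (fun x => f (hdeform x) * (hjacobian x)%:E)%E.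
  apply: emeasurable_funM; first exact: (measurableT_comp mf measurable_hdeform).
  by apply/measurable_EFinP; exact: measurable_hjacobian.
have fJ0 x : (0 <= f (hdeform x) * (hjacobian x)%:E)%E.
  by rewrite mule_ge0// lee_fin hjacobian_ge0.
rewrite (ge0_integral_plane21 mfJ fJ0).
rewrite (ge0_integral_plane21 mf f0); apply: eq_integral => t _.
have [S [Tinc TK SK]] := slice_bijection t.
rewrite -[RHS](@ge0_integral_increasing_bijection _
  (fun x => x + eps * chi t * chi x) S (fun x => 1 + eps * chi t * dcutoff rho x))//.
- by apply: measurable_funD => //; apply: measurable_funM => //; exact: measurable_cutoff.
- by apply: measurable_funD => //; apply: measurable_funM => //; exact: measurable_dcutoff.
- by move=> x; exact: (hjacobian_ge0 (x, t)).
- by move=> b c bc; rewrite integral_1Ddcutoff//; have := rho4; lra.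
- exact: measurable_fun_pair1.
Qed.

(** The inverse [S t] on the line of height [t] is not explicit. It is jointly
    measurable because [q < S t u] means [T t q < u], where the forward map [T] is
    measurable in [t]. *)
Lemma hdeform_inverse : exists Ti : plane R -> plane R,
  [/\ measurable_fun setT Ti, cancel hdeform Ti & cancel Ti hdeform].
Proof.
pose S t := sval (cid (slice_bijection t)).
have SP t : [/\ {homo (fun x => x + eps * chi t * chi x) : x y / x < y},
    cancel (fun x => x + eps * chi t * chi x) (S t) &
    cancel (S t) (fun x => x + eps * chi t * chi x)].
  by rewrite /S; case: cid.
exists (fun x => (S x.2 x.1, x.2)); split.
- apply: measurable_plane_fun => //.
  apply: (measurability _ (RGenOInfty.measurableE R)) => //.
  move=> /= _ [_ [q ->] <-]; rewrite setTI.
  rewrite [X in measurable X](_ : _ =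
    [set x : plane R | q + eps * chi x.2 * chi q < x.1]).
    have mq : measurable_fun setT (fun x : plane R => q + eps * chi x.2 * chi q).
      by apply: measurable_funD => //; do 2 apply: measurable_funM => //.
    have /(_ measurableT [set true]) := measurable_fun_ltr mq m1.
    by rewrite setTI; apply.
  apply/seteqP; split => -[u t] /=; rewrite in_itv/= andbT;
    have [inc0 TK SK] := SP t;
    have inc x y : x < y -> x + eps * chi t * chi x < y + eps * chi t * chi y
      by exact: inc0.
    by move=> /inc; rewrite SK.
  move=> h; rewrite ltNge; apply/negP; rewrite le_eqVlt => /orP[/eqP e|/inc].
    by move: h; rewrite -e SK ltxx.
  by rewrite SK ltNge (ltW h).
- by move=> [u t]; rewrite /hdeform/=; have [_ TK _] := SP t; rewrite TK.
- by move=> [u t]; rewrite /hdeform/=; have [_ _ SK] := SP t; rewrite SK.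
Qed.

(** The deformation along [(1, a)], obtained by conjugating the one along the
    first axis with an area-preserving shear. *)
Definition deform (x : plane R) : plane R := shear a (hdeform (shear (- a) x)).

Definition jacobian (x : plane R) : R := hjacobian (shear (- a) x).

Lemma measurable_deform : measurable_fun setT deform.
Proof.
apply: (measurableT_comp (measurable_shear a)).
exact: (measurableT_comp measurable_hdeform (measurable_shear _)).
Qed.

Lemma measurable_jacobian : measurable_fun setT jacobian.
Proof. exact: (measurableT_comp measurable_hjacobian (measurable_shear _)). Qed.

Lemma jacobian_ge0 x : 0 <= jacobian x.
Proof. exact: hjacobian_ge0. Qed.

Lemma deformE x : deform x = (x.1 + eps * bump (shear (- a) x),
  x.2 + a * (eps * bump (shear (- a) x))).
Proof.
rewrite /deform /hdeform /bump /shear/=; congr (_, _); first by ring.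
by ring.
Qed.

Lemma ge0_integral_deform f :
  measurable_fun setT f -> (forall x, 0 <= f x)%E ->
  (\int[mu]_x (f (deform x) * (jacobian x)%:E) = \int[mu]_x f x)%E.
Proof.
move=> mf f0.
rewrite -[RHS](@ge0_integral_shear a)//.
have mfs : measurable_fun setT (fun x => f (shear a x)).
  exact: (measurableT_comp mf (measurable_shear a)).
rewrite -[RHS](@ge0_integral_hdeform (f \o shear a))//=.
rewrite -[RHS](@ge0_integral_shear (- a))//.
- apply: emeasurable_funM; first exact: (measurableT_comp mfs measurable_hdeform).
  by apply/measurable_EFinP; exact: measurable_hjacobian.
- by move=> x; rewrite mule_ge0// lee_fin hjacobian_ge0.
Qed.

Lemma deform_inverse : exists Ti : plane R -> plane R,
  [/\ measurable_fun setT Ti, cancel deform Ti & cancel Ti deform].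
Proof.
have [Ti [mTi TK KT]] := hdeform_inverse.
exists (shear a \o Ti \o shear (- a)); split.
- apply: (measurableT_comp _ (measurable_shear _)).
  exact: (measurableT_comp (measurable_shear _) mTi).
- by move=> x; rewrite /deform/= shearK TK shearNK.
- by move=> x; rewrite /deform/= shearK KT shearNK.
Qed.

End deformation.

Section cutoff_region.
Variables (rho a : R).
Hypothesis rho4 : 4 <= rho.
Let rho0 : 0 < rho. Proof. by have := rho4; lra. Qed.

Lemma enorm_ge0 (x : plane R) : 0 <= enorm x.
Proof. exact: sqrtr_ge0. Qed.

Lemma enormK (x : plane R) : enorm x ^+ 2 = x.1 ^+ 2 + x.2 ^+ 2.
Proof. by rewrite /enorm sqr_sqrtr ?dot_ge0// /dot !expr2. Qed.

Lemma fst_le_enorm (x : plane R) : `|x.1| <= enorm x.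
Proof.
rewrite -ler_sqr ?nnegrE ?enorm_ge0// enormK real_normK ?num_real//.
by rewrite lerDl sqr_ge0.
Qed.

Lemma snd_le_enorm (x : plane R) : `|x.2| <= enorm x.
Proof.
rewrite -ler_sqr ?nnegrE ?enorm_ge0// enormK real_normK ?num_real//.
by rewrite lerDr sqr_ge0.
Qed.

(** If both factors of [bump] are nonzero, then [x.1] and [x.2 - a * x.1] are
    bounded by [2 * rho]. *)
Lemma bump_outside x : 2 * rho * (2 + `|a|) <= enorm x ->
  bump rho (shear (- a) x) = 0.
Proof.
move=> hx; rewrite /bump /shear/=.
have [h1|h1] := leP (2 * rho) `|x.1|; first by rewrite cutoff_eq0// mul0r.
have [h2|h2] := leP (2 * rho) `|x.2 + - a * x.1|; first by rewrite (cutoff_eq0 rho0 h2) mulr0.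
exfalso.
have r0 := rho0.
have h3 : `|x.2| <= 2 * rho * (1 + `|a|).
  have -> : x.2 = (x.2 + - a * x.1) + a * x.1 by ring.
  apply: le_trans (ler_normD _ _) _; rewrite normrM.
  have : `|a| * `|x.1| <= `|a| * (2 * rho) by rewrite ler_wpM2l// ltW.
  by lra.
have : enorm x ^+ 2 < (2 * rho * (2 + `|a|)) ^+ 2.
  rewrite enormK -[x.1 ^+ 2]real_normK ?num_real// -[x.2 ^+ 2]real_normK ?num_real//.
  have a0 := normr_ge0 a.
  have : `|x.1| ^+ 2 <= (2 * rho) ^+ 2.
    by rewrite ler_sqr ?nnegrE//; lra.
  have : `|x.2| ^+ 2 <= (2 * rho * (1 + `|a|)) ^+ 2.
    by rewrite ler_sqr ?nnegrE//; nra.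
  have : 0 < (2 * rho) ^+ 2 by rewrite exprn_gt0//; lra.
  rewrite !exprMn; set q := (2 ^+ 2 * rho ^+ 2); nra.
apply/negP; rewrite -leNgt ler_sqr ?nnegrE ?enorm_ge0//.
have a0 := normr_ge0 a; nra.
Qed.

Lemma bump_inside x : enorm x * (1 + `|a|) <= rho -> bump rho (shear (- a) x) = 1.
Proof.
move=> hx; have a0 := normr_ge0 a; have x0 := enorm_ge0 x.
have h1 := fst_le_enorm x; have h2 := snd_le_enorm x.
rewrite /bump /shear/= !cutoff_eq1 ?mul1r//.
- apply: le_trans (ler_normD _ _) _; rewrite normrM normrN.
  have : `|a| * `|x.1| <= `|a| * enorm x by rewrite ler_wpM2l.
  by lra.
- by nra.
Qed.

Lemma bump_lipschitz (x y : plane R) :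
  (bump rho (shear (- a) x) - bump rho (shear (- a) y)) ^+ 2 <=
  (2 * (2 + `|a|) / rho) ^+ 2 * dot (x.1 - y.1, x.2 - y.2) (x.1 - y.1, x.2 - y.2).
Proof.
set z : plane R := (x.1 - y.1, x.2 - y.2).
have -> : dot z z = enorm z ^+ 2 by rewrite /enorm sqr_sqrtr ?dot_ge0.
rewrite -exprMn -[_ ^+ 2]real_normK ?num_real// ler_sqr ?nnegrE//; last first.
  have a0 := normr_ge0 a.
  by rewrite mulr_ge0 ?enorm_ge0// divr_ge0 ?(ltW rho0)//; lra.
have h1 := fst_le_enorm z; have h2 := snd_le_enorm z; move: h1 h2 => /= h1 h2.
rewrite /bump /shear/=.
set p := x.2 + _; set q := y.2 + _.
have -> : cutoff rho x.1 * cutoff rho p - cutoff rho y.1 * cutoff rho q =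
  (cutoff rho x.1 - cutoff rho y.1) * cutoff rho p +
  cutoff rho y.1 * (cutoff rho p - cutoff rho q) by ring.
apply: le_trans (ler_normD _ _) _; rewrite !normrM.
have /andP[c0 c1] := cutoff_itv rho0 p; have /andP[d0 d1] := cutoff_itv rho0 y.1.
rewrite (ger0_norm c0) (ger0_norm d0).
have l1 := cutoff_lipschitz rho0 x.1 y.1; have l2 := cutoff_lipschitz rho0 p q.
have pq : `|p - q| <= (1 + `|a|) * enorm z.
  have -> : p - q = (x.2 - y.2) + - (a * (x.1 - y.1)) by rewrite /p /q; ring.
  apply: le_trans (ler_normD _ _) _; rewrite normrN normrM.
  have : `|a| * `|x.1 - y.1| <= `|a| * enorm z by rewrite ler_wpM2l.
  by lra.
apply: (@le_trans _ _ (`|cutoff rho x.1 - cutoff rho y.1| + `|cutoff rho p - cutoff rho q|)).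
  by apply: lerD; [rewrite -[leRHS]mulr1|rewrite -[leRHS]mul1r]; apply: ler_pM.
have rr : 0 <= 2 / rho by rewrite divr_ge0 ?(ltW rho0).
apply: (@le_trans _ _ (2 / rho * enorm z + 2 / rho * ((1 + `|a|) * enorm z))).
  by apply: lerD; [apply: le_trans l1 _|apply: le_trans l2 _]; apply: ler_wpM2l.
by rewrite le_eqVlt; apply/orP; left; apply/eqP; ring.
Qed.

End cutoff_region.

End plane_change_of_variables.

(** * Interactions, null sets and submodularity of the perimeter *)

Section monotone_integral.
Local Open Scope ereal_scope.
Context d (T : measurableType d) (R : realType) (mu : {measure set T -> \bar R}).

Import HBNNSimple.

(** The integral of a nonnegative function is a supremum over the simple
    functions below it, hence monotone without any measurability. *)
Lemma ge0_le_integral_nonmeasurable (f g : T -> \bar R) :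
  (forall x, 0 <= f x) -> (forall x, f x <= g x) ->
  \int[mu]_x f x <= \int[mu]_x g x.
Proof.
move=> f0 fg; have g0 x : 0 <= g x by exact: le_trans (f0 x) (fg x).
rewrite !ge0_integralTE//; apply: ge_ereal_sup => _ [h /= hf <-].
by apply: ereal_sup_ubound; exists h => //= x; exact: le_trans (hf x) (fg x).
Qed.

Lemma ge0_le_integral_subset_nonmeasurable (A B : set T) (f g : T -> \bar R) :
  A `<=` B -> (forall x, 0 <= f x) -> (forall x, f x <= g x) ->
  \int[mu]_(x in A) f x <= \int[mu]_(x in B) g x.
Proof.
move=> AB f0 fg; rewrite (integral_mkcond A) (integral_mkcond B).
apply: ge0_le_integral_nonmeasurable => x; rewrite !patchE; case: ifPn => // xA.
have -> : x \in B by rewrite inE; apply: AB; rewrite inE in xA.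
  exact: fg.
by case: ifPn => // _; exact: le_trans (f0 x) (fg x).
Qed.

End monotone_integral.

Section lebesgue_plane.
Context {R : realType}.
Local Open Scope ereal_scope.

Lemma sigma_finite_plane : sigma_finite setT (leb2 R).
Proof.
pose I (n : nat) : set (measurableTypeR R) := (`[- n%:R, n%:R]%classic)%R.
have mI n : measurable (I n) by exact: measurable_itv.
exists (fun n => I n `*` I n).
  apply/esym/seteqP; split => // -[x y] _.
  pose M := Num.max `|x|%R `|y|%R.
  have M0 : (0 <= M)%R by rewrite le_max normr_ge0.
  have := archi_boundP M0; rewrite gt_max => /andP[/ltW xM /ltW yM].
  by exists (Num.bound M) => //; split; rewrite /I /= in_itv/= -ler_norml.
move=> n; split; first exact: measurableX.
rewrite product_measure1E//= lebesgue_measure_itv/=.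
by case: ifP => _; rewrite ?mule0// -EFinB -EFinM ltry.
Qed.

(** [leb2] under a name of its own, from which its sigma-finiteness can be
    inferred. *)
Definition lebesgue_plane : set (plane R) -> \bar R := leb2 R.

HB.instance Definition _ := Measure.copy lebesgue_plane (leb2 R).
HB.instance Definition _ :=
  Measure_isSigmaFinite.Build _ _ _ lebesgue_plane sigma_finite_plane.

End lebesgue_plane.

Section interactions.
Context {R : realType}.
Variable s : R.
Local Notation mu := (leb2 R).
Local Notation K := (Defs.kernel s).
Local Notation L := (interaction s).
Implicit Types (A B E F N Omega : set (plane R)).
Local Open Scope ereal_scope.

Definition pair_integral (h : plane R -> plane R -> R) : \bar R :=
  \int[mu]_x \int[mu]_y (h x y)%:E.

Definition pair_integrand (h : plane R -> plane R -> R) :=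
  (forall x y, (0 <= h x y)%R) /\
  measurable_fun setT (fun p : plane R * plane R => h p.1 p.2).

Lemma measurable_pair_integrand h : pair_integrand h ->
  measurable_fun setT (fun p : plane R * plane R => (h p.1 p.2)%:E).
Proof. by move=> [_ mh]; exact/measurable_EFinP. Qed.

Lemma measurable_pair_integrand_inner h : pair_integrand h ->
  measurable_fun setT (fun x => \int[mu]_y (h x y)%:E).
Proof.
move=> wh; have h0 (p : plane R * plane R) : 0 <= (h p.1 p.2)%:E.
  by rewrite lee_fin; exact: wh.1.
exact: (@measurable_fun_fubini_tonelli_F _ _ (plane R) (plane R) R
  (@lebesgue_plane R) _ (measurable_pair_integrand wh) h0).
Qed.

Lemma measurable_pair_integrand_slice h x : pair_integrand h ->
  measurable_fun setT (fun y => (h x y)%:E).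
Proof. by move=> wh; exact: (measurable_fun_pair2 x (measurable_pair_integrand wh)). Qed.

Lemma pair_integrand_inner_ge0 h x : pair_integrand h -> 0 <= \int[mu]_y (h x y)%:E.
Proof. by move=> [h0 _]; apply: integral_ge0 => y _; rewrite lee_fin. Qed.

Lemma pair_integrandD g h : pair_integrand g -> pair_integrand h -> pair_integrand (fun x y => g x y + h x y)%R.
Proof.
move=> [g0 mg] [h0 mh]; split; first by move=> x y; rewrite addr_ge0.
exact: measurable_funD.
Qed.

Lemma pair_integrandM g h : pair_integrand g -> pair_integrand h -> pair_integrand (fun x y => g x y * h x y)%R.
Proof.
move=> [g0 mg] [h0 mh]; split; first by move=> x y; rewrite mulr_ge0.
exact: measurable_funM.
Qed.

Lemma pair_integrand_kernel : pair_integrand K.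
Proof. by split; [exact: kernel_ge0|exact: measurable_kernel]. Qed.

Lemma pair_integralD g h : pair_integrand g -> pair_integrand h ->
  pair_integral (fun x y => g x y + h x y)%R = pair_integral g + pair_integral h.
Proof.
move=> wg wh; rewrite /pair_integral -ge0_integralD//; first last.
- exact: measurable_pair_integrand_inner.
- by move=> x _; exact: pair_integrand_inner_ge0.
- exact: measurable_pair_integrand_inner.
- by move=> x _; exact: pair_integrand_inner_ge0.
apply: eq_integral => x _; rewrite -ge0_integralD//; first last.
- exact: measurable_pair_integrand_slice.
- by move=> y _; rewrite lee_fin; exact: wh.1.
- exact: measurable_pair_integrand_slice.
- by move=> y _; rewrite lee_fin; exact: wg.1.
Qed.

Lemma pair_integralZ (c : R) h : (0 <= c)%R -> pair_integrand h ->
  pair_integral (fun x y => c * h x y)%R = c%:E * pair_integral h.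
Proof.
move=> c0 wh; rewrite /pair_integral -ge0_integralZl//; first last.
- by move=> x _; exact: pair_integrand_inner_ge0.
- exact: measurable_pair_integrand_inner.
apply: eq_integral => x _; rewrite -ge0_integralZl//; first last.
- by move=> y _; rewrite lee_fin; exact: wh.1.
- exact: measurable_pair_integrand_slice.
Qed.

Lemma le_pair_integral g h : pair_integrand g -> (forall x y, (g x y <= h x y)%R) ->
  pair_integral g <= pair_integral h.
Proof.
move=> wg gh; apply: ge0_le_integral_nonmeasurable => x.
  exact: pair_integrand_inner_ge0.
apply: ge0_le_integral_nonmeasurable => y; rewrite lee_fin//; exact: wg.1.
Qed.

Lemma eq_pair_integral g h : (forall x y, g x y = h x y) -> pair_integral g = pair_integral h.
Proof.
by move=> gh; apply: eq_integral => x _; apply: eq_integral => y _; rewrite gh.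
Qed.

Lemma measurable_indic_fst A : measurable A ->
  measurable_fun setT (fun p : plane R * plane R => \1_A p.1 : R).
Proof.
move=> mA; have mi : measurable_fun setT (\1_A : plane R -> R).
  exact: measurable_indic.
exact: (measurableT_comp mi measurable_fst).
Qed.

Lemma measurable_indic_snd A : measurable A ->
  measurable_fun setT (fun p : plane R * plane R => \1_A p.2 : R).
Proof.
move=> mA; have mi : measurable_fun setT (\1_A : plane R -> R).
  exact: measurable_indic.
exact: (measurableT_comp mi measurable_snd).
Qed.

Lemma pair_integrand_indic A B : measurable A -> measurable B ->
  pair_integrand (fun x y => \1_A x * \1_B y)%R.
Proof.
move=> mA mB; split; first by move=> x y; rewrite mulr_ge0.
apply: measurable_funM; [exact: measurable_indic_fst|exact: measurable_indic_snd].
Qed.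

Lemma interactionE A B : L A B = pair_integral (fun x y => \1_A x * \1_B y * K x y)%R.
Proof.
rewrite /interaction /pair_integral integral_mkcond; apply: eq_integral => x _.
rewrite patchE integral_mkcond indicE; case: ifPn => _.
  apply: eq_integral => y _; rewrite patchE indicE mul1r.
  by case: ifPn; rewrite ?mul1r ?mul0r.
by rewrite [RHS]integral0_eq// => y _; rewrite !mul0r.
Qed.

Lemma interaction_ge0 A B : 0 <= L A B.
Proof.
apply: integral_ge0 => x _; apply: integral_ge0 => y _.
by rewrite lee_fin kernel_ge0.
Qed.

Lemma le_interaction A A' B B' : A `<=` A' -> B `<=` B' -> L A B <= L A' B'.
Proof.
move=> AA BB; apply: ge0_le_integral_subset_nonmeasurable => // x.
  by apply: integral_ge0 => y _; rewrite lee_fin kernel_ge0.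
apply: ge0_le_integral_subset_nonmeasurable => // y.
by rewrite lee_fin kernel_ge0.
Qed.

Lemma interaction_setD_null A B N : measurable A -> measurable B ->
  measurable N -> mu N = 0 -> L (A `\` N) (B `\` N) = L A B.
Proof.
move=> mA mB mN N0; rewrite /interaction.
have mi C : measurable C -> measurable_fun setT
    (fun x => \int[mu]_(y in C) (K x y)%:E).
  move=> mC; have w1 : pair_integrand (fun x y => \1_C y * K x y)%R.
    by apply: pair_integrandM pair_integrand_kernel; split => //; exact: measurable_indic_snd.
  rewrite (_ : (fun _ => _) = (fun x => \int[mu]_y (\1_C y * K x y)%:E)).
    exact: (measurable_pair_integrand_inner w1).
  apply/funext => x; rewrite integral_mkcond; apply: eq_integral => y _.
  by rewrite patchE indicE; case: ifPn; rewrite ?mul1r ?mul0r.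
have i0 C x : 0 <= \int[mu]_(y in C) (K x y)%:E.
  by apply: integral_ge0 => y _; rewrite lee_fin kernel_ge0.
have mB1 := measurable_funTS (D := A) (mi _ mB).
rewrite [RHS](ge0_negligible_integral mN mA mB1 (fun x _ => i0 B x) N0).
apply: eq_integral => x _.
have mK : measurable_fun B (fun y => (K x y)%:E).
  apply: measurable_funTS.
  apply/measurable_EFinP; exact: (measurable_fun_pair2 x (measurable_kernel s)).
have K0 y : B y -> 0 <= (K x y)%:E by rewrite lee_fin kernel_ge0.
exact/esym/(ge0_negligible_integral mN mB mK K0 N0).
Qed.

(** [A] and [B] need not be Borel: they are squeezed between Borel sets that
    differ by [N], and interactions are monotone for arbitrary sets. *)
Lemma interaction_ae A A' B B' N : measurable A' -> measurable B' ->
  measurable N -> mu N = 0 ->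
  (forall x, ~ N x -> A x <-> A' x) -> (forall x, ~ N x -> B x <-> B' x) ->
  L A B = L A' B'.
Proof.
move=> mA mB mN + AA BB.
have UD C : (C `|` N) `\` N = C `\` N.
  by apply/seteqP; split => x /= [h Nx]; split => //; [case: h|left].
have AN : A `<=` A' `|` N.
  by move=> x hx; have [Nx|Nx] := pselect (N x); [right|left; apply/AA].
have BN : B `<=` B' `|` N.
  by move=> x hx; have [Nx|Nx] := pselect (N x); [right|left; apply/BB].
have A'N : A' `\` N `<=` A by move=> x [hx Nx]; apply/AA.
have B'N : B' `\` N `<=` B by move=> x [hx Nx]; apply/BB.
have mAN := measurableU _ _ mA mN; have mBN := measurableU _ _ mB mN.
move=> N0; apply/eqP; rewrite eq_le; apply/andP; split.
- apply: le_trans (le_interaction AN BN) _.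
  rewrite -(interaction_setD_null mAN mBN mN N0) !UD.
  by rewrite (interaction_setD_null mA mB mN N0).
- rewrite -(interaction_setD_null mA mB mN N0).
  exact: le_interaction.
Qed.

Lemma s_perimeter_ae E E' Omega N : measurable E' -> measurable Omega ->
  measurable N -> mu N = 0 -> (forall x, ~ N x -> E x <-> E' x) ->
  s_perimeter s E Omega = s_perimeter s E' Omega.
Proof.
move=> mE mO mN + EE.
have h1 x : ~ N x -> (E `&` Omega) x <-> (E' `&` Omega) x.
  by move=> /EE h /=; rewrite h.
have h2 x : ~ N x -> (~` E) x <-> (~` E') x by move=> /EE h /=; rewrite h.
have h3 x : ~ N x -> (E `\` Omega) x <-> (E' `\` Omega) x.
  by move=> /EE h /=; rewrite h.
have h4 x : ~ N x -> (Omega `\` E) x <-> (Omega `\` E') x.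
  by move=> /EE h /=; rewrite h.
have mI := measurableI _ _ mE mO; have mC := measurableC mE.
have mD := measurableD mE mO; have mD' := measurableD mO mE.
move=> N0; rewrite /s_perimeter (interaction_ae mI mC mN N0 h1 h2).
rewrite (interaction_ae mD mD' mN N0 h3 h4).
exact: erefl.
Qed.

(** The perimeter counts the pairs in [E * ~` E] that are not both outside
    [Omega]. *)
Definition perimeter_weight E Omega (x y : plane R) : R :=
  (\1_E x * \1_(~` E) y * (1 - \1_(~` Omega) x * \1_(~` Omega) y))%R.

Lemma s_perimeterE E Omega : measurable E -> measurable Omega ->
  s_perimeter s E Omega = pair_integral (fun x y => perimeter_weight E Omega x y * K x y)%R.
Proof.
move=> mE mO; rewrite /s_perimeter !interactionE -pair_integralD; first last.
- by apply: pair_integrandM pair_integrand_kernel; apply: pair_integrand_indic; exact: measurableD.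
- apply: pair_integrandM pair_integrand_kernel.
  by apply: pair_integrand_indic; [exact: measurableI|exact: measurableC].
apply: eq_pair_integral => x y; rewrite /perimeter_weight -mulrDl !indicE; congr (_ * _)%R.
rewrite !in_setD !in_setI !in_setC.
by case: (x \in E); case: (x \in Omega); case: (y \in E); case: (y \in Omega);
  rewrite /=; ring.
Qed.

Lemma pair_integrand_perimeter E Omega : measurable E -> measurable Omega ->
  pair_integrand (perimeter_weight E Omega).
Proof.
move=> mE mO; split.
  move=> x y; rewrite /perimeter_weight !indicE.
  by do ![case: (_ \in _)]; rewrite /= ?(mulr0, mulr1, subr0, subrr).
apply: measurable_funM; first by apply: measurable_funM; 
  [exact: measurable_indic_fst|apply: measurable_indic_snd; exact: measurableC].
apply: measurable_funB => //.
by apply: measurable_funM; [apply: measurable_indic_fst|apply: measurable_indic_snd]; exact: measurableC.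
Qed.

(** A pointwise inequality between the integrands: the pairs in
    [(E \ F) * (F \ E)] are counted for [E], but neither for the union nor for
    the intersection. Their points lie in [Omega]. *)
Lemma s_perimeter_submodular E F Omega : measurable E -> measurable F ->
  measurable Omega -> E `\` Omega = F `\` Omega ->
  s_perimeter s (E `|` F) Omega + s_perimeter s (E `&` F) Omega +
    L (E `\` F) (F `\` E) <=
  s_perimeter s E Omega + s_perimeter s F Omega.
Proof.
move=> mE mF mO EF.
have mU := measurableU _ _ mE mF; have mI := measurableI _ _ mE mF.
have mEF := measurableD mE mF; have mFE := measurableD mF mE.
have wP X mX := pair_integrandM (@pair_integrand_perimeter X Omega mX mO) pair_integrand_kernel.
have wX := pair_integrandM (pair_integrand_indic mEF mFE) pair_integrand_kernel.
rewrite (s_perimeterE mU mO) (s_perimeterE mI mO) (s_perimeterE mE mO).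
rewrite (s_perimeterE mF mO) interactionE.
have wUI := pair_integrandD (wP _ mU) (wP _ mI).
rewrite -[leRHS](pair_integralD (wP _ mE) (wP _ mF)).
have := pair_integralD wUI wX; rewrite (pair_integralD (wP _ mU) (wP _ mI)) => <-.
apply: le_pair_integral; first exact: pair_integrandD wUI wX.
move=> x y; rewrite -!mulrDl ler_wpM2r ?kernel_ge0//.
have hx : x \notin Omega -> (x \in E) = (x \in F).
  move=> xO; have : (x \in E `\` Omega) = (x \in F `\` Omega) by rewrite EF.
  by rewrite !in_setD xO !andbT.
rewrite /perimeter_weight !indicE !in_setC !in_setD !in_setU !in_setI.
case: (boolP (x \in Omega)) hx => [_ _|_ /(_ isT) ->].
  by case: (x \in E); case: (x \in F); case: (y \in E); case: (y \in F);
    case: (y \in Omega); rewrite /=; lra.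
by case: (x \in F); case: (y \in E); case: (y \in F);
  case: (y \in Omega); rewrite /=; lra.
Qed.

Lemma measurable_eball (r : R) : measurable (eball r : set (plane R)).
Proof.
rewrite /eball (_ : [set x | _] = (fun x => enorm x) @^-1` `]-oo, r[%classic).
  rewrite -[X in measurable X]setTI.
  have mn : measurable_fun setT (fun x : plane R => enorm x).
    rewrite (_ : (fun _ => _) = (fun t : measurableTypeR R => t `^ (2^-1))%R \o
      (fun x : plane R => x.1 * x.1 + x.2 * x.2)%R).
      apply: (measurableT_comp (measurable_powR _)).
      by apply: measurable_funD; apply: measurable_funM;
        [exact: measurable_fst..|exact: measurable_snd|exact: measurable_snd].
    by apply/funext => x; rewrite /enorm -powR12_sqrt ?dot_ge0.
  by apply: mn => //; exact: measurable_itv.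
by apply/seteqP; split => x /=; rewrite in_itv.
Qed.

(** [E] is the union of a Borel set [A] and a null set. Competitors of [A] and [E]
    correspond to each other, with equal perimeters. *)
Lemma s_minimal_borel E : s_minimal s E ->
  exists A N : set (plane R), [/\ measurable A, measurable N, mu N = 0,
    (forall x, ~ N x -> E x <-> A x) &
    forall r : R, (0 < r)%R ->
      s_perimeter s A (eball r) < +oo /\
      (forall F, measurable F -> A `\` eball r = F `\` eball r ->
        s_perimeter s A (eball r) <= s_perimeter s F (eball r))].
Proof.
move=> hmin; have [mE _ _] := hmin 1%R ltr01.
case: mE => A mA [N0 [N [mN Nz N0N]] EE].
have EA x : ~ N x -> E x <-> A x.
  move=> Nx; rewrite -EE; split; last by left.
  by case => // /N0N.
have negN : mu.-negligible N0 by exists N.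
exists A, N; split; [exact: mA|exact: mN|exact: Nz|exact: EA|move=> r r0].
have mO := measurable_eball r.
have [_ fin min] := hmin r r0.
have PE := s_perimeter_ae mA mO mN Nz EA.
rewrite -PE; split; first exact: fin.
move=> F mF AF; pose F' := F `|` (N0 `\` eball r).
(* the null part of [E] is kept outside the ball only, where the competitor has
   to coincide with [E] *)
have F'F x : ~ N x -> F' x <-> F x.
  move=> Nx; split; last by left.
  by case=> [Fx|[/N0N Nx' _]]; [exact: Fx|case: (Nx Nx')].
have mF' : lebesgue_measurable F'.
  exists F; first exact: mF.
  exists (N0 `\` eball r); last exact: erefl.
  by apply: negligibleS negN => x [].
have EF : E `\` eball r = F' `\` eball r.
  by rewrite /F' -EE !setDUl AF setDDl setUid.
rewrite -(s_perimeter_ae mF mO mN Nz F'F).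
exact: min.
Qed.

End interactions.

(** * Deformations and dilations of the perimeter *)

Section null_sets.
Context {R : realType}.
Local Notation mu := (leb2 R).
Local Open Scope ereal_scope.

Lemma measurable_preimage_plane (T : plane R -> plane R) (A : set (plane R)) :
  measurable_fun setT T -> measurable A -> measurable (T @^-1` A).
Proof. by move=> mT mA; rewrite -[X in measurable X]setTI; exact: mT. Qed.

Lemma measure_integral_indic (A : set (plane R)) : measurable A ->
  \int[mu]_x (\1_A x)%:E = mu A.
Proof. by move=> mA; rewrite integral_indic// setIT. Qed.

Lemma measurable_indicE (A : set (plane R)) : measurable A ->
  measurable_fun setT (fun x => (\1_A x)%:E : \bar R).
Proof. by move=> mA; apply/measurable_EFinP; exact: measurable_indic. Qed.

Lemma translate_null (v : plane R) (N : set (plane R)) :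
  measurable N -> mu N = 0 -> mu (translate v @^-1` N) = 0.
Proof.
move=> mN N0; have mT := measurable_preimage_plane (measurable_translate v) mN.
rewrite -measure_integral_indic//.
have := @ge0_integral_translate _ v (fun x => (\1_N x)%:E) (measurable_indicE mN).
by rewrite measure_integral_indic// N0; apply => x; rewrite lee_fin.
Qed.

Lemma dilate_null (r : R) (N : set (plane R)) : (0 < r)%R ->
  measurable N -> mu N = 0 -> mu (dilate r @^-1` N) = 0.
Proof.
move=> r0 mN N0; have mT := measurable_preimage_plane (measurable_dilate r) mN.
rewrite -measure_integral_indic//.
have := @ge0_integral_dilate_plane _ r (fun x => (\1_N x)%:E) r0 (measurable_indicE mN).
rewrite measure_integral_indic// N0 => /(_ _)/eqP.
rewrite mule_eq0 eqe expf_eq0/= (gt_eqF r0)/= => h.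
by apply/eqP; apply: h => x; rewrite lee_fin.
Qed.

End null_sets.

Section deformed_interaction.
Context {R : realType}.
Variable s : R.
Local Notation mu := (leb2 R).
Local Notation K := (Defs.kernel s).
Local Notation L := (interaction s).
Implicit Types (A B E F N : set (plane R)).
Local Open Scope ereal_scope.

Section change_of_variables.
Variables (T Ti : plane R -> plane R) (J : plane R -> R).
Hypothesis mT : measurable_fun setT T.
Hypothesis mTi : measurable_fun setT Ti.
Hypothesis TK : cancel T Ti.
Hypothesis mJ : measurable_fun setT J.
Hypothesis J0 : forall x, (0 <= J x)%R.
Hypothesis cov : forall f : plane R -> \bar R, measurable_fun setT f ->
  (forall x, 0 <= f x) -> \int[mu]_x (f (T x) * (J x)%:E) = \int[mu]_x f x.

Lemma pair_integrand_pullback : pair_integrand (fun x y => J x * J y * K (T x) (T y))%R.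
Proof.
split; first by move=> x y; rewrite !mulr_ge0// kernel_ge0.
apply: measurable_funM.
  apply: measurable_funM; first exact: (measurableT_comp mJ measurable_fst).
  exact: (measurableT_comp mJ measurable_snd).
have mTT : measurable_fun setT (fun p : plane R * plane R => (T p.1, T p.2)).
  by apply: measurable_fun_pair; [exact: (measurableT_comp mT measurable_fst)|
    exact: (measurableT_comp mT measurable_snd)].
exact: (measurableT_comp (measurable_kernel s) mTT).
Qed.

(** The sets are preimages under the inverse [Ti], that is, images under [T]. *)
Lemma interaction_change_of_variables A B : measurable A -> measurable B ->
  L (Ti @^-1` A) (Ti @^-1` B) =
  pair_integral (fun x y => \1_A x * \1_B y * (J x * J y * K (T x) (T y)))%R.
Proof.
move=> mA mB.
have mA' := measurable_preimage_plane mTi mA.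
have mB' := measurable_preimage_plane mTi mB.
have iT C x : \1_(Ti @^-1` C) (T x) = \1_C x :> R.
  rewrite !indicE; congr (_%:R); congr nat_of_bool.
  by apply/idP/idP; rewrite !inE /= TK.
have wL := pair_integrandM (pair_integrand_indic mA' mB') (pair_integrand_kernel s).
have g0 x y : 0 <= (\1_(Ti @^-1` A) x * \1_(Ti @^-1` B) y * K x y)%:E.
  by rewrite lee_fin; exact: wL.1.
rewrite interactionE /pair_integral.
rewrite -(cov (measurable_pair_integrand_inner wL) (fun x => pair_integrand_inner_ge0 x wL)).
apply: eq_integral => x _.
rewrite -(cov (measurable_pair_integrand_slice (T x) wL) (g0 (T x))).
rewrite -ge0_integralZr//; first last.
- by rewrite lee_fin.
- by move=> y _; rewrite mule_ge0// lee_fin.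
- apply: emeasurable_funM; last exact/measurable_EFinP.
  exact: (measurableT_comp (measurable_pair_integrand_slice (T x) wL) mT).
apply: eq_integral => y _; rewrite -!EFinM !iT; congr EFin; ring.
Qed.

End change_of_variables.

(** The two area elements contribute [r ^ 4], the kernel [r ^ (- (2 + s))]. *)
Lemma interaction_dilate (r : R) A B : (0 < r)%R -> measurable A -> measurable B ->
  L (dilate r^-1 @^-1` A) (dilate r^-1 @^-1` B) = (r `^ (2 - s))%:E * L A B.
Proof.
move=> r0 mA mB.
have r20 : (0 <= r ^+ 2)%R by rewrite exprn_ge0 ?ltW.
have mT := measurable_dilate r; have mTi := measurable_dilate r^-1.
have TK : cancel (dilate r) (dilate r^-1) by apply: dilateK; rewrite gt_eqF.
have mJ : measurable_fun setT (fun _ : plane R => (r ^+ 2)%R) by [].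
have cov (f : plane R -> \bar R) : measurable_fun setT f -> (forall x, 0 <= f x) ->
    \int[mu]_x (f (dilate r x) * (r ^+ 2)%:E) = \int[mu]_x f x.
  move=> mf f0; rewrite -(ge0_integral_dilate_plane r0 mf f0).
  have mfs : measurable_fun setT (fun x => f (dilate r x)).
    exact: (measurableT_comp mf mT).
  have fs0 x : setT x -> 0 <= f (dilate r x) by [].
  by rewrite (ge0_integralZr _ measurableT mfs fs0) ?lee_fin// muleC.
rewrite (interaction_change_of_variables mT mTi TK mJ (fun _ => r20) cov mA mB).
have wL := pair_integrandM (pair_integrand_indic mA mB) (pair_integrand_kernel s).
rewrite interactionE -(pair_integralZ (powR_ge0 r (2 - s)%R) wL); apply: eq_pair_integral => x y.
rewrite /dilate kernel_dilate//.
have r2 : (r ^+ 2 = r `^ 2)%R by rewrite -(powR_mulrn 2) ?ltW.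
have rN : r != 0%R by rewrite gt_eqF.
have pD (p q : R) : (r `^ (p + q) = r `^ p * r `^ q)%R.
  by rewrite powRD// rN implybT.
rewrite r2 (_ : 2 - s = 2 + 2 + (- (2 + s)))%R; last by ring.
rewrite !pD; ring.
Qed.

Lemma s_perimeter_dilate (r : R) E Omega : (0 < r)%R ->
  measurable E -> measurable Omega ->
  s_perimeter s (dilate r^-1 @^-1` E) (dilate r^-1 @^-1` Omega) =
  (r `^ (2 - s))%:E * s_perimeter s E Omega.
Proof.
move=> r0 mE mO; rewrite /s_perimeter.
have mI := measurableI _ _ mE mO; have mC := measurableC mE.
have mD := measurableD mE mO; have mD' := measurableD mO mE.
rewrite ge0_muleDr ?interaction_ge0//.
by rewrite -(interaction_dilate r0 mI mC) -(interaction_dilate r0 mD mD').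
Qed.

Section deform_both_ways.
Hypothesis s0 : (0 < s)%R.
Hypothesis s1 : (s < 1)%R.
Variables (rho a : R).
Let kappa : R := (2 + `|a|)%R.
Hypothesis rho8 : (8 * kappa ^+ 2 <= rho)%R.
Let d : R := (2 * kappa ^+ 2 / rho)%R.

Let kappa2 : (2 <= kappa)%R. Proof. by rewrite lerDl. Qed.
Let rho4 : (4 <= rho)%R.
Proof. by have := rho8; have := kappa2 => h1 h2; nra. Qed.
Let rho0 : (0 < rho)%R. Proof. by have := rho4; lra. Qed.
Let d0 : (0 <= d)%R.
Proof. by rewrite divr_ge0 ?(ltW rho0)// mulr_ge0// sqr_ge0. Qed.
Let d4 : (d <= 1 / 4)%R.
Proof. by rewrite ler_pdivrMr//; have := rho8; lra. Qed.
Let rhod : (rho^-1 <= d)%R.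
Proof.
rewrite /d -[leLHS]mul1r ler_wpM2r// ?invr_ge0 ?(ltW rho0)//.
by have := kappa2 => h; nra.
Qed.

Let eps1 : (`|1 : R| <= 1)%R. Proof. by rewrite normr1. Qed.
Let epsN1 : (`|-1 : R| <= 1)%R. Proof. by rewrite normrN1. Qed.

(** With [d] of order [1 / rho], the cutoff moves the difference [x - y] by at
    most [d] times its length, and its Jacobian differs from [1] by at most [d]. *)
Lemma kernel_deform_both_ways x y :
  (jacobian rho a 1 x * jacobian rho a 1 y *
     K (deform rho a 1 x) (deform rho a 1 y) +
   jacobian rho a (-1) x * jacobian rho a (-1) y *
     K (deform rho a (-1) x) (deform rho a (-1) y) <=
  (2 + 1000 * d ^+ 2) * K x y)%R.
Proof.
pose j z := (cutoff rho (shear (- a) z).2 * dcutoff rho (shear (- a) z).1)%R.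
have jE1 z : (jacobian rho a 1 z = 1 + j z)%R.
  by rewrite /jacobian /hjacobian mul1r.
have jEN z : (jacobian rho a (-1) z = 1 - j z)%R.
  by rewrite /jacobian /hjacobian mulN1r mulNr.
have jd z : (`|j z| <= d)%R.
  apply: le_trans rhod; have := hjacobian_dev rho4 eps1 (shear (- a) z).
  by rewrite mul1r.
rewrite !jE1 !jEN.
pose b z := bump rho (shear (- a) z).
pose w : plane R := ((b x - b y)%R, (a * (b x - b y))%R).
apply: (@kernel_deformation_le _ s _ _ _ _ _ w) => //;
  rewrite ?deformE /w/=; try (rewrite /b; ring).
set D := dot ((x.1 - y.1)%R, _) _.
have -> : dot ((b x - b y)%R, (a * (b x - b y))%R) ((b x - b y)%R, (a * (b x - b y))%R)
  = ((1 + a ^+ 2) * (b x - b y) ^+ 2)%R by rewrite /dot/=; ring.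
have bl := bump_lipschitz a rho4 x y.
apply: (@le_trans _ _ (kappa ^+ 2 * (b x - b y) ^+ 2)%R).
  rewrite ler_wpM2r ?sqr_ge0// /kappa -[(a ^+ 2)%R]real_normK ?num_real//.
  by have := normr_ge0 a => h; nra.
apply: le_trans (ler_wpM2l (sqr_ge0 _) bl) _.
rewrite le_eqVlt; apply/orP; left; apply/eqP; rewrite /d -/kappa /D.
by field; rewrite gt_eqF.
Qed.

Variables Tp Tm : plane R -> plane R.
Hypothesis mTp : measurable_fun setT Tp.
Hypothesis mTm : measurable_fun setT Tm.
Hypothesis TpK : cancel (deform rho a 1) Tp.
Hypothesis KTp : cancel Tp (deform rho a 1).
Hypothesis TmK : cancel (deform rho a (-1)) Tm.
Hypothesis KTm : cancel Tm (deform rho a (-1)).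

Lemma interaction_deform_both_ways A B : measurable A -> measurable B ->
  L (Tp @^-1` A) (Tp @^-1` B) + L (Tm @^-1` A) (Tm @^-1` B) <=
  (2 + 1000 * d ^+ 2)%:E * L A B.
Proof.
move=> mA mB.
have cp := @ge0_integral_deform R rho a 1 rho4 eps1.
have cm := @ge0_integral_deform R rho a (-1) rho4 epsN1.
have mDp := @measurable_deform R rho a 1.
have mDm := @measurable_deform R rho a (-1).
have mJp := @measurable_jacobian R rho a 1.
have mJm := @measurable_jacobian R rho a (-1).
have J0p := @jacobian_ge0 R rho a 1 rho4 eps1.
have J0m := @jacobian_ge0 R rho a (-1) rho4 epsN1.
rewrite (interaction_change_of_variables mDp mTp TpK mJp J0p cp mA mB).
rewrite (interaction_change_of_variables mDm mTm TmK mJm J0m cm mA mB).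
have wI := pair_integrand_indic mA mB.
have wp := pair_integrandM wI (pair_integrand_pullback mDp mJp J0p).
have wm := pair_integrandM wI (pair_integrand_pullback mDm mJm J0m).
have wL := pair_integrandM wI (pair_integrand_kernel s).
have c0 : (0 <= 2 + 1000 * d ^+ 2)%R by have := sqr_ge0 d; lra.
rewrite -(pair_integralD wp wm) interactionE -(pair_integralZ c0 wL).
apply: le_pair_integral; first exact: (pair_integrandD wp wm).
move=> x y; rewrite -mulrDr [leRHS]mulrCA; apply: ler_wpM2l; first exact: (wI.1 x y).
exact: kernel_deform_both_ways.
Qed.

End deform_both_ways.
End deformed_interaction.

(** * Vanishing interaction of a minimal cone with its translates *)

Section flatness_estimate.
Context {R : realType}.
Variable s : R.
Hypothesis s0 : 0 < s.
Hypothesis s1 : s < 1.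
Local Notation mu := (leb2 R).
Local Notation K := (Defs.kernel s).
Local Notation L := (interaction s).
Implicit Types (A B E F N : set (plane R)).
Local Open Scope ereal_scope.

Lemma s_perimeter_ge0 E Omega : 0 <= s_perimeter s E Omega.
Proof. by rewrite adde_ge0// interaction_ge0. Qed.

(** If [q ^ s = (C + 1) / l], then [C * r ^ (- s) < l] for every [r >= q]. *)
Lemma le_powRN_eq0 (C c : R) (l : \bar R) : (0 <= C)%R -> (0 <= c)%R ->
  0 <= l -> (forall r : R, (c <= r)%R -> l <= (C * r `^ (- s))%:E) -> l = 0.
Proof.
move=> C0 c0 l0 bound; apply/eqP; rewrite eq_le l0 andbT leNgt; apply/negP.
case: l l0 bound => [l| |]// _ bound; last first.
  by have := bound c (lexx c); rewrite leye_eq.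
rewrite lte_fin => l0.
have Cl : (0 < (C + 1) / l)%R by rewrite divr_gt0// ltr_wpDl.
pose q := (((C + 1) / l) `^ (s^-1))%R.
have q0 : (0 < q)%R by rewrite powR_gt0.
have qs : (q `^ s = (C + 1) / l)%R.
  by rewrite /q -powRrM mulVf ?gt_eqF// powRr1// ltW.
have cr : (c <= c + q)%R by rewrite lerDl ltW.
have := bound _ cr; rewrite lee_fin powRN.
have rs : (q `^ s <= (c + q) `^ s)%R.
  have q0' := ltW q0; apply: ge0_ler_powR; rewrite ?nnegrE ?lerDr ?addr_ge0//.
  exact: ltW.
have rs0 : (0 < (c + q) `^ s)%R by apply: lt_le_trans rs; rewrite powR_gt0.
rewrite ler_pdivlMr// => h.
move: rs; rewrite qs ler_pdivrMr// (mulrC _ l) => /le_trans /(_ h).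
by rewrite gerDl ler10.
Qed.

Definition borel_minimal A := forall r : R, (0 < r)%R ->
  s_perimeter s A (eball r) < +oo /\
  (forall F, measurable F -> A `\` eball r = F `\` eball r ->
    s_perimeter s A (eball r) <= s_perimeter s F (eball r)).

(** Each of the union, the intersection and [G] has perimeter at least that of
    [A], so submodularity leaves for the interaction only what the sum of the
    perimeters of [F] and [G] has in excess of twice the perimeter of [A]. *)
Lemma interaction_setD_le_excess (c : R) A F G (r : R) : (0 < r)%R ->
  (0 <= c)%R ->
  measurable A -> measurable F -> measurable G -> borel_minimal A ->
  A `\` eball r = F `\` eball r -> A `\` eball r = G `\` eball r ->
  s_perimeter s F (eball r) + s_perimeter s G (eball r) <=
    (2 + c)%:E * s_perimeter s A (eball r) ->
  L (A `\` F) (F `\` A) <= c%:E * s_perimeter s A (eball r).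
Proof.
move=> r0 c0 mA mF mG /(_ r r0) [Afin Amin] AF AG FG.
have AG' := Amin _ mG AG.
have AU : s_perimeter s A (eball r) <= s_perimeter s (A `|` F) (eball r).
  by apply: Amin; [exact: measurableU|rewrite setDUl -AF setUid].
have AI : s_perimeter s A (eball r) <= s_perimeter s (A `&` F) (eball r).
  apply: Amin; first exact: measurableI.
  apply/seteqP; split => x [Ax Ox].
    have [Fx _] : (F `\` eball r) x by rewrite -AF.
    by split.
  by case: Ax.
have sub := s_perimeter_submodular s mA mF (measurable_eball r) AF.
have := s_perimeter_ge0 A (eball r); have := s_perimeter_ge0 F (eball r).
have := s_perimeter_ge0 G (eball r).
have := s_perimeter_ge0 (A `|` F) (eball r).
have := s_perimeter_ge0 (A `&` F) (eball r).
have := interaction_ge0 s (A `\` F) (F `\` A).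
move: sub AU AI AG' FG Afin.
move: (s_perimeter _ A _) (s_perimeter _ F _) (s_perimeter _ G _)
  (s_perimeter _ (A `|` F) _) (s_perimeter _ (A `&` F) _) (L _ _).
move=> [pA| |] [pF| |] [pG| |] [pU| |] [pI| |] [l| |] //;
  rewrite -?EFinM -?EFinD ?lee_fin//; lra.
Qed.

Section translated_competitor.
Variables (rho a : R).
Local Notation kappa := (2 + `|a|)%R.
Hypothesis rho8 : (8 * kappa ^+ 2 <= rho)%R.

Let kappa2 : (2 <= kappa)%R. Proof. by rewrite lerDl. Qed.
Let rho4 : (4 <= rho)%R.
Proof. by have := rho8; have := kappa2 => h1 h2; nra. Qed.

Local Notation Omega := (eball (2 * rho * kappa)%R : set (plane R)).

Lemma deform_outside (eps : R) x : ~ Omega x -> deform rho a eps x = x.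
Proof.
move=> /negP; rewrite -leNgt => hx.
by rewrite deformE bump_outside// !mulr0 !addr0; case: x {hx}.
Qed.

Lemma preimage_inverse_outside (eps : R) (Ti : plane R -> plane R) :
  cancel (deform rho a eps) Ti -> cancel Ti (deform rho a eps) ->
  (forall x, ~ Omega x -> Ti x = x) /\ Ti @^-1` Omega = Omega.
Proof.
move=> TK KT.
have fix_out x : ~ Omega x -> Ti x = x.
  by move=> hx; rewrite -{1}(deform_outside eps hx) TK.
split => //; apply/seteqP; split => x /= hx.
  by apply: contrapT => nx; move: hx; rewrite (fix_out x nx).
apply: contrapT => nx; have := deform_outside eps nx; rewrite KT => xT.
by apply: nx; rewrite -xT.
Qed.

(** The competitor is the image of [A] under the deformation along [(1, a)]; the
    opposite deformation provides the second set needed to bound its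
    perimeter. *)
Lemma translated_competitor A : measurable A -> borel_minimal A ->
  exists F, [/\ measurable F,
    L (A `\` F) (F `\` A) <=
      (1000 * (2 * kappa ^+ 2 / rho) ^+ 2)%:E * s_perimeter s A Omega &
    forall x, (enorm x * (1 + `|a|) <= rho)%R -> F (translate (1%R, a) x) <-> A x].
Proof.
move=> mA minA.
have e1 : (`|1 : R| <= 1)%R by rewrite normr1.
have eN1 : (`|-1 : R| <= 1)%R by rewrite normrN1.
have [Tp [mTp TpK KTp]] := deform_inverse a rho4 e1.
have [Tm [mTm TmK KTm]] := deform_inverse a rho4 eN1.
have [Tpo TpO] := preimage_inverse_outside TpK KTp.
have [Tmo TmO] := preimage_inverse_outside TmK KTm.
have mF := measurable_preimage_plane mTp mA.
have mG := measurable_preimage_plane mTm mA.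
have mO := measurable_eball (2 * rho * kappa)%R.
have outE (Ti : plane R -> plane R) : (forall x, ~ Omega x -> Ti x = x) ->
    A `\` Omega = Ti @^-1` A `\` Omega.
  by move=> Tio; apply/seteqP; split => x [/= Ax Ox]; split => //=;
    move: Ax; rewrite Tio.
exists (Tp @^-1` A); split => //.
- have r0 : (0 < 2 * rho * kappa)%R.
    have rho0 : (0 < rho)%R by have := rho4; lra.
    by rewrite !mulr_gt0//; have := kappa2; lra.
  have c0 : (0 <= 1000 * (2 * kappa ^+ 2 / rho) ^+ 2)%R.
    by have := sqr_ge0 (2 * kappa ^+ 2 / rho)%R; lra.
  apply: (interaction_setD_le_excess r0 c0 mA mF mG minA (outE _ Tpo) (outE _ Tmo)).
  have key X Y mX mY := interaction_deform_both_ways s0 s1 rho8 mTp mTm TpK TmK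
    (A:=X) (B:=Y) mX mY.
  have k1 : L (Tp @^-1` A `&` Tp @^-1` Omega) (~` (Tp @^-1` A)) +
      L (Tm @^-1` A `&` Tm @^-1` Omega) (~` (Tm @^-1` A)) <= _ :=
    key _ _ (measurableI _ _ mA mO) (measurableC mA).
  have k2 : L (Tp @^-1` A `\` Tp @^-1` Omega) (Tp @^-1` Omega `\` Tp @^-1` A) +
      L (Tm @^-1` A `\` Tm @^-1` Omega) (Tm @^-1` Omega `\` Tm @^-1` A) <= _ :=
    key _ _ (measurableD mA mO) (measurableD mO mA).
  rewrite TpO TmO in k1; rewrite TpO TmO in k2.
  rewrite /s_perimeter ge0_muleDr ?interaction_ge0// addeACA.
  exact: leeD k1 k2.
- move=> x hx /=; have <- : deform rho a 1 x = translate (1%R, a) x.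
    by rewrite deformE bump_inside// !mulr1.
  by rewrite TpK.
Qed.

End translated_competitor.

(** A Borel set that agrees with a cone up to a null set need not be a cone. *)
Definition ae_dilation_invariant A := exists N, [/\ measurable N, mu N = 0 &
  forall r : R, (0 < r)%R -> forall x, ~ N x -> ~ N (dilate r x) ->
    A x <-> A (dilate r x)].

Lemma s_perimeter_ae_cone A (r : R) : (0 < r)%R -> measurable A ->
  ae_dilation_invariant A ->
  s_perimeter s A (eball r) = (r `^ (2 - s))%:E * s_perimeter s A (eball 1).
Proof.
move=> r0 mA [N [mN N0 Ainv]].
have ri0 : (0 < r^-1)%R by rewrite invr_gt0.
have mD := measurable_dilate r^-1.
have mA' := measurable_preimage_plane mD mA.
have mN' := measurable_preimage_plane mD mN.
have mO : measurable (eball r : set (plane R)) := measurable_eball r.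
rewrite -(s_perimeter_dilate s r0 mA (measurable_eball 1%R)).
have -> : dilate r^-1 @^-1` eball 1 = eball r :> set (plane R).
  have eD (x : plane R) : enorm (dilate r^-1 x) = (r^-1 * enorm x)%R.
    rewrite /enorm (_ : dot _ _ = r^-1 ^+ 2 * dot x x)%R.
      by rewrite sqrtrM ?sqr_ge0// sqrtr_sqr ger0_norm// ltW.
    by rewrite /dot /dilate/=; ring.
  by apply/seteqP; split => x /=; rewrite /eball/= eD mulrC ltr_pdivrMr// mul1r.
have mNN := measurableU _ _ mN mN'.
apply: (s_perimeter_ae s mA' mO mNN).
  by rewrite [LHS]measureU0//; exact: dilate_null.
by move=> x /not_orP[Nx Nx']; exact: Ainv.
Qed.

Lemma enorm_le (x : plane R) : (enorm x <= `|x.1| + `|x.2|)%R.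
Proof.
rewrite -ler_sqr ?nnegrE ?enorm_ge0 ?addr_ge0// enormK.
rewrite -[(x.1 ^+ 2)%R]real_normK ?num_real// -[(x.2 ^+ 2)%R]real_normK ?num_real//.
by have := normr_ge0 x.1; have := normr_ge0 x.2 => h1 h2; nra.
Qed.

(** Let [r = 2 * rho * k] be the radius of the ball that contains the support of
    the cutoff. The excess is of order [rho ^ (- 2)] times the perimeter
    [r ^ (2 - s)] of the cone, that is, [r ^ (- s)]; the two sets do not depend on
    [r]. *)
Lemma interaction_translate_eq0 A (a M : R) : measurable A -> borel_minimal A ->
  ae_dilation_invariant A -> (0 < M)%R ->
  L [set y | [/\ A y, ~ A (translate (- 1, - a)%R y) & eball M y]]
    [set y | [/\ ~ A y, A (translate (- 1, - a)%R y) & eball M y]] = 0.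
Proof.
move=> mA minA Ainv M0; set X := [set y | _]; set Y := [set y | _].
pose k := (2 + `|a|)%R.
have k2 : (2 <= k)%R by rewrite lerDl.
have [P1fin _] := minA 1%R ltr01.
(* the first threshold makes the deformation small, the second one puts the
   translate of the ball of radius [M] where the cutoff is [1];
   16000 k ^ 6 = 1000 (2 k ^ 2 / rho) ^ 2 r ^ 2 *)
have bound (r : R) : (16 * k ^+ 3 <= r)%R -> (2 * k * (k * (2 * M + k)) <= r)%R ->
    L X Y <= (16000 * k ^+ 6 * r `^ (- s))%:E * s_perimeter s A (eball 1).
  move=> r1 r2.
  have k3 : (0 < k ^+ 3)%R by rewrite exprn_gt0//; lra.
  have r0 : (0 < r)%R by lra.
  pose rho := (r / (2 * k))%R.
  have k20 : (0 < 2 * k)%R by lra.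
  have rhoE : (2 * rho * k = r)%R by rewrite /rho; field; lra.
  have rho8 : (8 * k ^+ 2 <= rho)%R.
    by rewrite /rho ler_pdivlMr//; apply: le_trans r1; rewrite le_eqVlt;
      apply/orP; left; apply/eqP; ring.
  have [F [mF LF FA]] := translated_competitor rho8 mA minA.
  apply: (@le_trans _ _ (L (A `\` F) (F `\` A))).
    have FA' y : eball M y -> F y <-> A (translate (- 1, - a)%R y).
      move=> My; rewrite -FA; last first.
        apply: (@le_trans _ _ ((2 * M + k) * k)%R); last first.
          by rewrite /rho ler_pdivlMr// mulrC; apply: le_trans r2; rewrite (mulrC k).
        apply: ler_pM; rewrite ?enorm_ge0 ?addr_ge0//; last by rewrite /k; lra.
        apply: le_trans (enorm_le _) _; rewrite /translate/=.
        have h1 := fst_le_enorm y; have h2 := snd_le_enorm y.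
        have h3 := ler_normB y.1 (1 : R)%R; have h4 := ler_normB y.2 a.
        by rewrite normr1 in h3; move: My; rewrite /eball/= /k => My; lra.
      by rewrite /translate/= !subrK; case: y {My}.
    by apply: le_interaction => y [h1 h2 h3]; split => //; rewrite ?FA'//;
      move/(FA' y h3).
  apply: le_trans LF _; rewrite -/k rhoE (@s_perimeter_ae_cone A r)// muleA.
  rewrite -EFinM le_eqVlt; apply/orP; left; apply/eqP; congr (_%:E * _).
  have rN : r != 0%R by rewrite gt_eqF.
  have -> : (r `^ (2 - s) = r ^+ 2 * r `^ (- s))%R.
    by rewrite powRD ?rN ?implybT// (powR_mulrn 2) ?ltW.
  by rewrite /rho; field; rewrite rN/=; lra.
have L0 := interaction_ge0 s X Y.
move: (L X Y) L0 bound => l l0 {mA minA Ainv X Y} bound; clearbody k.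
have k0 : (0 <= k)%R by lra.
have k3 := exprn_ge0 3 k0; have k6 := exprn_ge0 6 k0.
have kM : (0 <= k * (k * (2 * M + k)))%R by rewrite !mulr_ge0// addr_ge0// mulr_ge0// ltW.
move: P1fin (s_perimeter_ge0 A (eball 1)) bound.
case: (s_perimeter _ _ _) => [p _|//|//]; rewrite lee_fin => p0 bound.
have pk := mulr_ge0 k6 p0.
have C0 : (0 <= 16000 * (k ^+ 6 * p))%R by lra.
have c0 : (0 <= 16 * k ^+ 3 + 2 * (k * (k * (2 * M + k))))%R by lra.
apply: (le_powRN_eq0 C0 c0 l0) => r hr; have := bound r; rewrite -EFinM.
have -> : (16000 * k ^+ 6 * r `^ (- s) * p = 16000 * (k ^+ 6 * p) * r `^ (- s))%R.
  by ring.
apply; lra.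
Qed.

(** Disjointness keeps [x] and [y] distinct: on the diagonal the kernel is [0]
    instead of being large. *)
Lemma interaction_lower_bound A B (M : R) : measurable A -> measurable B ->
  A `<=` eball M -> B `<=` eball M -> (forall x, A x -> ~ B x) -> (0 < M)%R ->
  ((4 * M + 1) `^ (- (2 + s)))%:E * (mu A * mu B) <= L A B.
Proof.
move=> mA mB AM BM AB M0.
have M1 : (0 < 4 * M + 1)%R by lra.
set c := (_ `^ _)%R.
have c0 : (0 < c)%R by rewrite powR_gt0.
have wI := pair_integrand_indic mA mB.
have -> : c%:E * (mu A * mu B) = pair_integral (fun x y => c * (\1_A x * \1_B y))%R.
  rewrite (pair_integralZ (ltW c0) wI); congr (_ * _); rewrite /pair_integral.
  have mi x y : (\1_A x * \1_B y)%:E = (\1_A x)%:E * (\1_B y)%:E :> \bar R by [].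
  under eq_integral => x _.
    under eq_integral do rewrite mi.
    rewrite ge0_integralZl//; first 1 last.
      exact: measurable_indicE.
    rewrite (measure_integral_indic mB) muleC.
    over.
  rewrite ge0_integralZl//; last exact: measurable_indicE.
  by rewrite (measure_integral_indic mA) muleC.
rewrite interactionE; apply: le_pair_integral.
  split; first by move=> x y; rewrite mulr_ge0 ?(ltW c0)//; exact: wI.1.
  by apply: measurable_funM => //; exact: wI.2.
move=> x y; rewrite mulrC !indicE.
have [xA|xA] := boolP (x \in A); last by rewrite !mul0r.
have [yB|yB] := boolP (y \in B); last by rewrite mulr0 !mul0r.
rewrite !mul1r kernelE; set z : plane R := (_, _).
rewrite inE in xA; rewrite inE in yB.
have z0 : (0 < enorm z)%R.
  rewrite lt_neqAle enorm_ge0 andbT; apply/eqP => z0.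
  have h1 := fst_le_enorm z; have h2 := snd_le_enorm z.
  rewrite -z0 !normr_le0 /z/= !subr_eq0 in h1 h2.
  have xy : x = y.
    by case: x y h1 h2 {z z0 xA yB} => ? ? [? ?] /= /eqP-> /eqP->.
  by apply: (AB x) => //; rewrite xy.
have zM : (enorm z <= 4 * M + 1)%R.
  apply: le_trans (enorm_le _) _; rewrite /z/=.
  have h1 := fst_le_enorm x; have h2 := snd_le_enorm x.
  have h3 := fst_le_enorm y; have h4 := snd_le_enorm y.
  have h5 := ler_normB x.1 y.1; have h6 := ler_normB x.2 y.2.
  by have := AM _ xA; have := BM _ yB; rewrite /eball/= => h7 h8; lra.
rewrite -kernelE /Defs.kernel -/z /c powRN lef_pV2 ?posrE ?powR_gt0//.
by apply: ge0_ler_powR => //; rewrite ?nnegrE ?enorm_ge0//; have := s0 => h; lra.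
Qed.

Lemma interaction_eq0 A B (M : R) : measurable A -> measurable B ->
  A `<=` eball M -> B `<=` eball M -> (forall x, A x -> ~ B x) -> (0 < M)%R ->
  L A B = 0 -> mu A = 0 \/ mu B = 0.
Proof.
move=> mA mB AM BM AB M0 LAB.
have := interaction_lower_bound mA mB AM BM AB M0; rewrite LAB.
have c0 : 0 < ((4 * M + 1) `^ (- (2 + s)))%:E.
  by rewrite lte_fin powR_gt0// ltr_wpDl// mulr_ge0// ltW.
rewrite pmule_rle0// => h.
have : mu A * mu B = 0 by apply/eqP; rewrite eq_le h mule_ge0.
by move/eqP; rewrite mule_eq0 => /orP[/eqP|/eqP]; [left|right].
Qed.

End flatness_estimate.

(** * Sets that are monotone under translations *)

Section classification.
Context {R : realType}.
Local Notation mu := (leb2 R).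
Implicit Types (A E N S : set (plane R)) (v w x y nu : plane R).

Section additive_cone.
Variable P : plane R -> Prop.
Hypothesis PD : forall v w, P v -> P w -> P (translate w v).
Hypothesis PZ : forall r v, 0 < r -> P v -> P (dilate r v).
Hypothesis P1 : forall b, P (1, b) \/ P (-1, - b).

Let Ppos (u t : R) : 0 < u -> P (1, t / u) -> P (u, t).
Proof.
by move=> u0 /(PZ u0); rewrite /dilate/= mulr1 mulrC divfK// gt_eqF.
Qed.

Let Pneg (u t : R) : u < 0 -> P (-1, - (t / u)) -> P (u, t).
Proof.
move=> u0; have u0' : 0 < - u by rewrite oppr_gt0.
by move=> /(PZ u0'); rewrite /dilate/= mulrNN mulr1 mulrNN mulrC divfK// lt_eqF.
Qed.

(** When [P] contains the upward vertical vectors, the slopes [b] with [(1, b)] in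
    [P] form an upper interval; the direction [(1, l)] of its infimum bounds the
    half-plane. *)
Let half_plane_of_vertical b1 b2 : (forall t, 0 < t -> P (0, t)) ->
  ~ P (1, b1) -> P (1, b2) ->
  exists nu, enorm nu = 1 /\ forall v, 0 < dot v nu -> P v.
Proof.
move=> Pv nb1 pb2; pose S : set R := [set b | P (1, b)].
have Sup b c : S b -> b < c -> S c.
  move=> Sb bc; have := @PD (1, b) (0, c - b) Sb (Pv _ _).
  rewrite subr_gt0 => /(_ bc).
  by rewrite /translate/= addr0 addrC subrK.
have S0 : S !=set0 by exists b2.
have lS : has_lbound S.
  exists b1 => c Sc; rewrite leNgt; apply/negP => cb.
  exact: (nb1 (Sup _ _ Sc cb)).
pose l := inf S.
have gtl b : l < b -> P (1, b).
  by move=> lb; have [c Sc cb] := inf_lt S0 lb; exact: Sup Sc cb.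
have ltl b : b < l -> P (-1, - b).
  move=> bl; have [Sb|//] := P1 b.
  by move: bl; rewrite ltNge => /negP[]; exact: ge_inf.
pose n := enorm ((- l, 1) : plane R).
have n0 : 0 < n.
  by rewrite /n /enorm sqrtr_gt0 /dot/= ltr_wpDl// -expr2 ?sqr_ge0.
have dnn : dot (- l, 1) (- l, 1) = n ^+ 2 :> R by rewrite sqr_sqrtr// dot_ge0.
exists (- l / n, 1 / n); split.
  rewrite /enorm (_ : dot _ _ = 1) ?sqrtr1//.
  have -> : dot (- l / n, 1 / n) (- l / n, 1 / n) =
    dot (- l, 1) (- l, 1) / n ^+ 2 :> R by rewrite /dot/=; field; rewrite gt_eqF.
  by rewrite dnn mulfV// expf_eq0/= gt_eqF.
move=> [u t].
have -> : dot (u, t) (- l / n, 1 / n) = (t - l * u) / n.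
  by rewrite /dot/=; field; rewrite gt_eqF.
rewrite pmulr_lgt0 ?invr_gt0// subr_gt0 => lt.
have [u0|u0|u0] := ltgtP u 0.
- by apply: Pneg => //; apply: ltl; rewrite ltr_ndivrMr.
- by apply: Ppos => //; apply: gtl; rewrite ltr_pdivlMr.
- by rewrite u0; apply: Pv; move: lt; rewrite u0 mulr0.
Qed.

Lemma half_plane_trichotomy :
  (exists nu, enorm nu = 1 /\ forall v, 0 < dot v nu -> P v) \/
  exists b1 b2, [/\ ~ P (1, b1), P (1, b2), P (-1, - b1) & b1 != b2].
Proof.
have [allp|/existsNP[b1 nb1]] := pselect (forall b, P (1, b)).
  left; exists (1, 0); split.
    by rewrite /enorm /dot/= mulr1 mulr0 addr0 sqrtr1.
  by move=> [u t]; rewrite /dot/= mulr1 mulr0 addr0 => u0; exact: Ppos.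
have [alln|/existsNP[b2 nb2]] := pselect (forall b, P (-1, - b)).
  left; exists (-1, 0); split.
    by rewrite /enorm /dot/= mulrNN mulr1 mulr0 addr0 sqrtr1.
  by move=> [u t]; rewrite /dot/= mulrN1 mulr0 addr0 oppr_gt0 => u0; exact: Pneg.
right; have pb2 : P (1, b2) by case: (P1 b2).
exists b1, b2; split => //; first by case: (P1 b1).
by apply/eqP => e; apply: nb1; rewrite e.
Qed.

(** The sum of [(1, b2)] and [(-1, - b1)] is vertical. *)
Lemma half_plane_of_ascent b1 b2 : ~ P (1, b1) -> P (1, b2) -> P (-1, - b1) ->
  b1 < b2 -> exists nu, enorm nu = 1 /\ forall v, 0 < dot v nu -> P v.
Proof.
move=> nb1 pb2 pb1 bb; apply: (half_plane_of_vertical _ nb1 pb2) => t t0.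
have e : P (0, b2 - b1) by have := PD pb2 pb1; rewrite /translate/= subrr.
have h : 0 < t / (b2 - b1) by rewrite divr_gt0// subr_gt0.
have := PZ h e; rewrite /dilate/= mulr0 divfK//.
by rewrite subr_eq0 gt_eqF.
Qed.

End additive_cone.

(** A vertical vector of [P] points up or down; the second case follows from the
    first by reflection in the horizontal axis. *)
Lemma half_plane_in_additive_cone (P : plane R -> Prop) :
  (forall v w, P v -> P w -> P (translate w v)) ->
  (forall r v, 0 < r -> P v -> P (dilate r v)) ->
  (forall b, P (1, b) \/ P (-1, - b)) ->
  exists nu, enorm nu = 1 /\ forall v, 0 < dot v nu -> P v.
Proof.
move=> PD PZ P1.
have [//|[b1 [b2 [nb1 pb2 pb1 bb]]]] := half_plane_trichotomy PZ P1.
have [lt|gt|e] := ltgtP b1 b2; last by move: bb; rewrite e eqxx.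
  exact: half_plane_of_ascent PD PZ P1 _ _ nb1 pb2 pb1 lt.
pose Q v := P (v.1, - v.2).
have [nu [nu1 nuP]] : exists nu, enorm nu = 1 /\ forall v, 0 < dot v nu -> Q v.
  have QD v w : Q v -> Q w -> Q (translate w v).
    by move=> Qv Qw; have := PD _ _ Qv Qw; rewrite /Q /translate/= opprD.
  have QZ r v : 0 < r -> Q v -> Q (dilate r v).
    by move=> r0 Qv; have := PZ _ _ r0 Qv; rewrite /Q /dilate/= mulrN.
  have Q1 b : Q (1, b) \/ Q (-1, - b) by exact: P1 (- b).
  apply: (@half_plane_of_ascent Q QD QZ Q1 (- b1) (- b2)).
  - by rewrite /Q/= opprK.
  - by rewrite /Q/= opprK.
  - by rewrite /Q/= opprK.
  - by rewrite ltrN2.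
exists (nu.1, - nu.2); split.
  by rewrite -nu1 /enorm /dot/= mulrNN.
move=> v; have := nuP (v.1, - v.2); rewrite /Q/= opprK -surjective_pairing.
by rewrite /dot/= mulNr mulrN.
Qed.

Section negligible.
Local Open Scope ereal_scope.

Lemma negligible_preimage_translate v S :
  mu.-negligible S -> mu.-negligible (translate v @^-1` S).
Proof.
move=> [N [mN N0 SN]]; exists (translate v @^-1` N); split.
- exact: measurable_preimage_plane (measurable_translate v) mN.
- exact: translate_null.
- by move=> x /SN.
Qed.

Lemma negligible_preimage_dilate r S : (0 < r)%R ->
  mu.-negligible S -> mu.-negligible (dilate r @^-1` S).
Proof.
move=> r0 [N [mN N0 SN]]; exists (dilate r @^-1` N); split.
- exact: measurable_preimage_plane (measurable_dilate r) mN.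
- exact: dilate_null.
- by move=> x /SN.
Qed.

Lemma line_negligible nu : enorm nu = 1%R ->
  mu.-negligible [set x | dot x nu = 0%R].
Proof.
move=> nu1; pose D : set (plane R) := [set x | dot x nu = 0%R].
have md : measurable_fun setT (fun x : plane R => dot x nu).
  by apply: measurable_funD; exact: measurable_funM.
have mD : measurable D.
  have -> : D = (fun x : plane R => dot x nu) @^-1` [set 0%R] by [].
  by rewrite -[X in measurable X]setTI; apply: md => //; exact: measurable_set1.
exists D; split => //.
have [n2|n2] := eqVneq nu.2 0%R.
  have n1 : nu.1 != 0%R.
    apply/eqP => n1; move: nu1; rewrite /enorm /dot n1 n2 !mulr0 addr0 sqrtr0.
    by move/eqP; rewrite eq_sym oner_eq0.
  have -> : D = [set 0%R] `*` setT.
    apply/seteqP; split => -[u t]; rewrite /D /dot/= n2 mulr0 addr0.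
      by move/eqP; rewrite mulf_eq0 (negbTE n1) orbF => /eqP.
    by move=> [-> _]; rewrite mul0r.
  by rewrite product_measure1E//= lebesgue_measure_set1 mul0e.
rewrite /product_measure1; apply: integral0_eq => u _ /=.
apply/eqP; rewrite -measure_le0; apply/eqP.
have : xsection D u `<=` [set (- (u * nu.1) / nu.2)%R].
  move=> t; rewrite /xsection/= inE /D /dot/= => /eqP.
  by rewrite addrC addr_eq0 => /eqP e; rewrite -e mulfK.
move=> sub; apply/eqP; rewrite -(lebesgue_measure_set1 (- (u * nu.1) / nu.2)%R).
apply: le_measure => //; rewrite inE; first exact: measurable_xsection.
exact: measurable_set1.
Qed.

(** The pairs [(x, v)] with [x] in [A], [v] in [H] and [x + v] outside [A] have
    null sections at each [v], hence null sections at almost every [x]. *)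
Lemma exists_translate_ae A N (H : set (plane R)) : measurable A ->
  measurable H -> mu.-negligible N -> ~ mu.-negligible A ->
  (forall v, H v -> mu.-negligible [set x | A x /\ ~ A (translate v x)]) ->
  exists x, [/\ A x, ~ N x & mu.-negligible [set v | H v /\ ~ A (translate v x)]].
Proof.
move=> mA mH negN nA HA.
pose G : set (plane R * plane R) :=
  [set p | [/\ A p.1, H p.2 & ~ A (translate p.2 p.1)]].
have mG : measurable G.
  have mt : measurable_fun setT (fun p : plane R * plane R => translate p.2 p.1).
    apply: measurable_fun_pair; apply: measurable_funD.
    - exact: (measurableT_comp measurable_fst measurable_fst).
    - exact: (measurableT_comp measurable_fst measurable_snd).
    - exact: (measurableT_comp measurable_snd measurable_fst).
    - exact: (measurableT_comp measurable_snd measurable_snd).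
  have -> : G = fst @^-1` A `&` snd @^-1` H `&`
      (fun p : plane R * plane R => translate p.2 p.1) @^-1` (~` A).
    by apply/seteqP; split => p /=; [move=> [? ? ?]|move=> [[? ?] ?]].
  apply: measurableI; first apply: measurableI.
  - by rewrite -[X in measurable X]setTI; apply: measurable_fst.
  - by rewrite -[X in measurable X]setTI; apply: measurable_snd.
  - by rewrite -[X in measurable X]setTI; apply: mt => //; exact: measurableC.
pose f (p : plane R * plane R) : \bar R := (\1_G p)%:E.
have mf : measurable_fun setT f by apply/measurable_EFinP; exact: measurable_indic.
have f0 p : 0 <= f p by rewrite lee_fin.
have mF : measurable_fun setT (fun x => \int[mu]_v f (x, v)).
  exact: (@measurable_fun_fubini_tonelli_F _ _ (plane R) (plane R) R
    (@lebesgue_plane R) f mf f0).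
have F0 x : 0 <= \int[mu]_v f (x, v) by apply: integral_ge0 => v _.
have negF : mu.-negligible
    (~` [set x | setT x -> \int[mu]_v f (x, v) = cst 0 x]).
  apply: (ae_eq_integral_abs mu measurableT mF).1.
  under eq_integral do rewrite gee0_abs//.
  rewrite (@fubini_tonelli _ _ (plane R) (plane R) R (@lebesgue_plane R)
    (@lebesgue_plane R) f mf f0).
  apply: integral0_eq => v _.
  rewrite (_ : (fun x => _) = (fun x => (\1_(ysection G v) x)%:E)); last first.
    by apply/funext => x; rewrite /f !indicE mem_ysection.
  have mY : measurable (ysection G v) by exact: measurable_ysection.
  rewrite (measure_integral_indic mY); apply/negligibleP; first exact: mY.
  have [Hv|Hv] := pselect (H v).
    by apply: negligibleS (HA v Hv) => x; rewrite /ysection/= inE => -[].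
  apply: negligibleS (negligible_set0 _) => x.
  by rewrite /ysection/= inE => -[].
have [x [Ax /not_orP[nN /contrapT Fx]]] : exists x, A x /\
    ~ (N `|` ~` [set x | setT x -> \int[mu]_v f (x, v) = cst 0 x]) x.
  apply: contrapT => h; apply: nA; apply: negligibleS (negligibleU negN negF).
  by move=> x Ax; apply: contrapT => nx; apply: h; exists x.
have {Fx} := Fx I.
rewrite (_ : (fun v => _) = (fun v => (\1_(xsection G x) v)%:E)); last first.
  by apply/funext => v; rewrite /f !indicE mem_xsection.
have mX : measurable (xsection G x) by exact: measurable_xsection.
rewrite (measure_integral_indic mX) => /(negligibleP _ mX) negX.
exists x; split; [exact: Ax|exact: nN|apply: negligibleS negX].
by move=> v [Hv nv]; rewrite /xsection/= inE.
Qed.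

(** Some [x] has [x + H] in [E] up to a null set, where [H] is the half-plane. As
    [E] is a cone, the same holds for [x / n + H], and the union of these sets over
    [n] is [H] or more. *)
Lemma half_plane_filled E A N nu : measurable A -> mu.-negligible N ->
  (forall x, ~ N x -> E x <-> A x) ->
  (forall r x, (0 < r)%R -> E (dilate r x) <-> E x) ->
  ~ mu.-negligible E ->
  (forall v, (0 < dot v nu)%R ->
    mu.-negligible [set x | E x /\ ~ E (translate v x)]) ->
  mu.-negligible [set x | (0 < dot x nu)%R /\ ~ E x].
Proof.
move=> mA negN EA Einv nE HE.
pose H : set (plane R) := [set v | (0 < dot v nu)%R].
have mH : measurable H.
  have md : measurable_fun setT (fun x : plane R => dot x nu).
    by apply: measurable_funD; exact: measurable_funM.
  have -> : H = (fun x : plane R => dot x nu) @^-1` `]0%R, +oo[.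
    by apply/seteqP; split => x /=; rewrite in_itv/= andbT.
  by rewrite -[X in measurable X]setTI; apply: md => //; exact: measurable_itv.
have nA : ~ mu.-negligible A.
  move=> h; apply: nE; apply: negligibleS (negligibleU h negN) => x Ex.
  by have [Nx|Nx] := pselect (N x); [right|left; apply/EA].
have HA v : H v -> mu.-negligible [set x | A x /\ ~ A (translate v x)].
  move=> Hv; apply: negligibleS (negligibleU (HE v Hv)
    (negligibleU negN (negligible_preimage_translate v negN))) => x [Ax nAv].
  have [Nx|Nx] := pselect (N x); first by right; left.
  have [Nv|Nv] := pselect (N (translate v x)); first by right; right.
  by left; split; [apply/EA|move/(EA _ Nv)].
have [x [Ax Nx Hx]] := exists_translate_ae mA mH negN nA HA.
(* [Z n] is the part of [x / n.+1 + H] missed by [E] *)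
pose Z n := [set y : plane R | (0 < dot y nu - n.+1%:R^-1 * dot x nu)%R /\ ~ E y].
have ZE n : mu.-negligible (Z n).
  have n0 : (0 < n.+1%:R :> R)%R by rewrite ltr0n.
  apply: negligibleS (negligible_preimage_dilate n0
    (negligible_preimage_translate (- x.1, - x.2)%R
      (negligibleU Hx (negligible_preimage_translate x negN)))) => y [hy nEy] /=.
  set v := translate _ _.
  have vx : translate x v = dilate n.+1%:R y by rewrite /v /translate/= !subrK.
  have [Nv|Nv] := pselect (N (translate x v)); first by right.
  left; split.
    rewrite /H/= (_ : dot v nu = n.+1%:R * (dot y nu - n.+1%:R^-1 * dot x nu))%R.
      by rewrite mulr_gt0.
    by rewrite /v /dot /translate /dilate/=; field; rewrite gt_eqF.
  have -> : translate v x = translate x v by rewrite /translate ![(x.1 + _)%R]addrC ![(x.2 + _)%R]addrC.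
  by move/(EA _ Nv); rewrite vx (Einv _ y n0).
apply: negligibleS (negligible_bigcup ZE) => y [hy nEy].
pose n := Num.bound (dot x nu / dot y nu).
have hn : (dot x nu / dot y nu < n.+1%:R)%R.
  have [xy|xy] := leP 0%R (dot x nu / dot y nu)%R.
    by apply: lt_trans (archi_boundP xy) _; rewrite ltr_nat.
  exact: lt_trans xy _.
exists n => //; split => //=.
rewrite subr_gt0 mulrC ltr_pdivrMr ?ltr0n// mulrC.
by move: hn; rewrite ltr_pdivrMr.
Qed.

End negligible.

End classification.

Section monotonicity.
Context {R : realType}.
Local Notation mu := (leb2 R).
Implicit Types (A E N S : set (plane R)) (v w x y nu : plane R).

(** On each ball one of the two differences is null. If the first one is not null
    on some ball, it is not null on any larger one, so the second one is. *)
Lemma translate_monotone s A (a : R) : 0 < s -> s < 1 -> measurable A ->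
  borel_minimal s A -> ae_dilation_invariant A ->
  mu.-negligible [set y | A y /\ ~ A (translate (- 1, - a) y)] \/
  mu.-negligible [set y | ~ A y /\ A (translate (- 1, - a) y)].
Proof.
move=> s0 s1 mA minA Ainv.
have mT := measurable_preimage_plane (measurable_translate (- 1, - a)) mA.
pose X : set (plane R) := [set y | A y /\ ~ A (translate (- 1, - a) y)].
pose Y : set (plane R) := [set y | ~ A y /\ A (translate (- 1, - a) y)].
have mX : measurable X := measurableD mA mT.
have mY : measurable Y.
  by apply: measurableI => //; exact: measurableC.
pose B n : set (plane R) := eball n.+1%:R.
have mB n : measurable (B n) by exact: measurable_eball.
have mXB n : measurable (X `&` B n) by exact: measurableI.
have mYB n : measurable (Y `&` B n) by exact: measurableI.
have BS m n : (m <= n)%N -> B m `<=` B n.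
  by move=> mn x; rewrite /B /eball/= => /lt_le_trans; apply; rewrite ler_nat.
have cover Z : Z `<=` \bigcup_n (Z `&` B n).
  move=> x Zx; exists (Num.bound (enorm x)) => //; split => //.
  rewrite /B /eball/=; apply: lt_trans (archi_boundP (enorm_ge0 x)) _.
  by rewrite ltr_nat.
have dich n : mu.-negligible (X `&` B n) \/ mu.-negligible (Y `&` B n).
  have n0 : 0 < n.+1%:R :> R by rewrite ltr0n.
  have L0 := interaction_translate_eq0 s0 s1 a mA minA Ainv n0.
  have LXY : interaction s (X `&` B n) (Y `&` B n) = 0%E.
    rewrite -[RHS]L0; congr (interaction s _ _); apply/seteqP; split => x.
    - by move=> [[? ?] ?].
    - by move=> [? ? ?].
    - by move=> [[? ?] ?].
    - by move=> [? ? ?].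
  have disj x : (X `&` B n) x -> ~ (Y `&` B n) x by move=> [[? _] _] [[]].
  have [h|h] := interaction_eq0 s0 (mXB n) (mYB n) (@subIsetr _ X (B n))
    (@subIsetr _ Y (B n)) disj n0 LXY.
  - by left; apply/negligibleP.
  - by right; apply/negligibleP.
have [allX|/existsNP[m nXm]] := pselect (forall n, mu.-negligible (X `&` B n)).
  by left; apply: negligibleS (negligible_bigcup allX); exact: cover.
right; apply: negligibleS (@cover Y) (negligible_bigcup _) => n.
have [|h] := dich (maxn m n).
  by move=> h; exfalso; apply: nXm; apply: negligibleS h; apply: setIS;
    apply: BS; exact: leq_maxl.
by apply: negligibleS h; apply: setIS; apply: BS; exact: leq_maxr.
Qed.

End monotonicity.

Theorem theorem1 (R : realType) (s : R) (hs0 : 0 < s) (hs1 : s < 1)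
    (E : set (plane R)) (hmin : s_minimal s E) (hcone : cone E)
    (hE : ~ (leb2 R).-negligible E) (hEc : ~ (leb2 R).-negligible (~` E)) :
  exists H : set (plane R),
    half_plane H /\ (leb2 R).-negligible (E `+` H).
Proof.
have [A [N [mA mN N0 EA minA]]] := s_minimal_borel hmin.
have negN : (leb2 R).-negligible N by apply/negligibleP.
have Ecl r (x : plane R) : 0 < r -> E x -> E (dilate r x).
  by move=> r0 Ex; rewrite -(hcone r r0); exists x.
have Einv r (x : plane R) : 0 < r -> E (dilate r x) <-> E x.
  move=> r0; split; last exact: Ecl.
  by move/(@Ecl r^-1); rewrite invr_gt0 dilateK ?gt_eqF//; apply.
have Ainv : ae_dilation_invariant A.
  exists N; split => // r r0 x nx nrx.
  by rewrite -(EA _ nx) -(EA _ nrx) Einv.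
pose P (v : plane R) := (leb2 R).-negligible [set x | E x /\ ~ E (translate v x)].
have PD v w : P v -> P w -> P (translate w v).
  move=> Pv Pw.
  apply: negligibleS (negligibleU Pv (negligible_preimage_translate v Pw)).
  move=> x [Ex nE]; have [Ev|Ev] := pselect (E (translate v x)); last by left.
  by right; split => //; rewrite /translate/= -!addrA.
have PZ r v : 0 < r -> P v -> P (dilate r v).
  move=> r0 Pv; have ri0 : 0 < r^-1 by rewrite invr_gt0.
  apply: negligibleS (negligible_preimage_dilate ri0 Pv) => x [Ex nE] /=.
  split; first by apply/Einv.
  move=> h; apply: nE; apply/(Einv _ _ ri0).
  suff -> : dilate r^-1 (translate (dilate r v) x) = translate v (dilate r^-1 x) by [].
  by rewrite /dilate /translate/= !mulrDr !mulKf// gt_eqF.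
have P1 b : P (1, b) \/ P (-1, - b).
  have [hX|hY] := translate_monotone b hs0 hs1 mA minA Ainv.
  - right; apply: negligibleS (negligibleU hX (negligibleU negN
      (negligible_preimage_translate (-1, - b) negN))) => x [Ex nE].
    have [Nx|Nx] := pselect (N x); first by right; left.
    have [Nv|Nv] := pselect (N (translate (-1, - b) x)); first by right; right.
    by left; split; [apply/EA|move/(EA _ Nv)].
  - left; apply: negligibleS (negligibleU (negligible_preimage_translate (1, b) hY)
      (negligibleU negN (negligible_preimage_translate (1, b) negN))) => x [Ex nE].
    have [Nx|Nx] := pselect (N x); first by right; left.
    have [Nv|Nv] := pselect (N (translate (1, b) x)); first by right; right.
    left; split => /=; first by move/(EA _ Nv).
    by rewrite /translate/= !addrK -surjective_pairing; apply/EA.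
have [nu [nu1 nuP]] := half_plane_in_additive_cone PD PZ P1.
have dotNr (v : plane R) : dot v (- nu.1, - nu.2) = - dot v nu.
  by rewrite /dot/= !mulrN opprD.
have fillE := half_plane_filled mA negN EA Einv hE nuP.
have fillC : (leb2 R).-negligible
    [set x | 0 < dot x (- nu.1, - nu.2) /\ ~ (~` E) x].
  apply: (@half_plane_filled _ _ (~` A) N) => //.
  - exact: measurableC.
  - by move=> x /EA h; rewrite /setC/= h.
  - by move=> r x r0; rewrite /setC/= Einv.
  - move=> v; rewrite dotNr => v0.
    have Pv : P (- v.1, - v.2) by apply: nuP; move: v0; rewrite /dot/= !mulNr opprD.
    apply: negligibleS (negligible_preimage_translate v Pv) => x [nE /contrapT EE] /=.
    split; first exact: EE.
    by rewrite /translate/= !addrK -surjective_pairing.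
exists [set x | 0 < dot x nu]; split; first by exists nu, 0.
apply: negligibleS (negligibleU fillE (negligibleU fillC (line_negligible nu1))).
move=> x [[Ex /negP]|[/= hx nE]]; last by left.
rewrite -leNgt le_eqVlt => /predU1P[x0|x0]; first by right; right.
by right; left; split; [rewrite dotNr oppr_gt0|move=> /(_ Ex)].
Qed.
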